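(* Let $\Gamma=\mathbf{Z}\times_\sigma\mathbf{Z}_2$ be the infinite dihedral group. The cyclic cohomology of the (complex) group ring $\mathbf{C}\Gamma$ is given by $$HC^n(\mathbf{C}\Gamma)\cong\begin{cases}\mathbf{C}^3\times\prod_{p\ge 1}\mathbf{C} & n=0,\\ 0 & n=1,3,5,\dots,\\ \mathbf{C}^3 & n=2,4,6,\dots\end{cases}$$
   Context: $\mathbf{Z}_2$ acts on $\mathbf{Z}$ by inversion, so $\Gamma$ is generated by $S,e$ with relations $e^2=1$, $eSe=S^{-1}$. $HC^n$ denotes Connes' cyclic cohomology, i.e. the cohomology of the complex of cyclic cochains (multilinear functionals $\phi$ with $\phi(a_n,a_0,\dots,a_{n-1})=(-1)^n\phi(a_0,\dots,a_n)$) with the Hochschild coboundary $b$; the group ring carries no topology, and cochains are arbitrary multilinear functionals. *)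

(* Defs.v *)
From HB Require Import structures.
From mathcomp Require Import all_boot all_order all_algebra finmap.
From mathcomp Require Import boolp functions reals.
From mathcomp Require Import generic_quotient ring_quotient complex monalg.

Set Implicit Arguments.
Unset Strict Implicit.
Unset Printing Implicit Defensive.

Import GRing.Theory Num.Theory.

Local Open Scope ring_scope.
Local Open Scope quotient_scope.

Definition lmod_isomorphic (k : nzRingType) (U V : lmodType k) : Prop :=
  exists f : {linear U -> V}, bijective f.

Section QuotientModule.
Variables (k : nzRingType) (V : lmodType k) (I : submodClosed V).

Definition submod_pred : {pred V} := fun x => x \in I.

Lemma submod_pred_zmod_closed : zmod_closed submod_pred.
Proof.
split=> [|x y xI yI]; rewrite unfold_in; first exact: rpred0.
by apply: rpredD => //; rewrite -scaleN1r; apply: rpredZ.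
Qed.

HB.instance Definition _ :=
  GRing.isZmodClosed.Build V submod_pred submod_pred_zmod_closed.

Definition quotmod : Type := (Quotient.quot submod_pred).

HB.instance Definition _ := GRing.Zmodule.on quotmod.
HB.instance Definition _ := EqQuotient.on quotmod.

(* Well defined on classes by [pi_quotmod_scale]. *)
Definition quotmod_scale (a : k) (x : quotmod) : quotmod :=
  \pi_quotmod (a *: repr x).

Lemma pi_quotmod_eq (x y : V) :
  (\pi_quotmod x = \pi_quotmod y) <-> (x - y \in I).
Proof.
split=> [xy|xyI].
  by apply/idP; rewrite -[_ \in I]/(x - y \in submod_pred) Quotient.idealrBE;
     apply/eqP.
by apply/eqP; rewrite -[_ == _]Quotient.idealrBE.
Qed.

Lemma pi_quotmod_scale a (x : V) :
  quotmod_scale a (\pi_quotmod x) = \pi_quotmod (a *: x).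
Proof.
apply/pi_quotmod_eq; rewrite -scalerBr; apply: rpredZ.
by apply/pi_quotmod_eq; rewrite reprK.
Qed.

Lemma pi_quotmodD (x y : V) :
  \pi_quotmod (x + y) = \pi_quotmod x + \pi_quotmod y.
Proof. exact: (@pi_addr _ _ _ _ _ (Quotient.quot submod_pred)). Qed.

Lemma quotmod_scaleA a b x :
  quotmod_scale a (quotmod_scale b x) = quotmod_scale (a * b) x.
Proof.
rewrite -[x]reprK (pi_quotmod_scale b (repr x)).
by rewrite (pi_quotmod_scale a (b *: repr x)) pi_quotmod_scale scalerA.
Qed.

Lemma quotmod_scale1 : left_id 1 quotmod_scale.
Proof. by move=> x; rewrite -[x]reprK pi_quotmod_scale scale1r. Qed.

Lemma quotmod_scaleDr : right_distributive quotmod_scale +%R.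
Proof.
move=> a x y; rewrite -[x]reprK -[y]reprK -pi_quotmodD.
by rewrite !pi_quotmod_scale scalerDr pi_quotmodD.
Qed.

Lemma quotmod_scaleDl x : {morph quotmod_scale^~ x : a b / a + b}.
Proof.
by move=> a b; rewrite -[x]reprK !pi_quotmod_scale scalerDl pi_quotmodD.
Qed.

HB.instance Definition _ := GRing.Zmodule_isLmodule.Build k quotmod
  quotmod_scaleA quotmod_scale1 quotmod_scaleDr quotmod_scaleDl.

End QuotientModule.

(* monalg makes {malg k[K]} a ring only for monoids K whose sole unit is 1,
   which excludes nontrivial groups; only its module structure is reused. *)
Definition grpalg (k : nzRingType) (G : groupType) : Type := {malg k[G]}.

Section GroupAlgebra.
Variables (k : comNzRingType) (G : groupType).
Local Notation A := (grpalg k G).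
Implicit Types (f g h : A) (x y z : G).

HB.instance Definition _ := GRing.Lmodule.on A.

Definition grpalg_one : A := << 1%g >>.

Definition grpalg_mul f g : A :=
  \sum_(x <- msupp f) \sum_(y <- msupp g) << f@_x * g@_y *g (x * y)%g >>.

Lemma grpalg_mulw (d1 d2 : {fset G}) f g :
  fsubset (msupp f) d1 -> fsubset (msupp g) d2 ->
  grpalg_mul f g = \sum_(x <- d1) \sum_(y <- d2) << f@_x * g@_y *g (x * y)%g >>.
Proof.
move=> le1 le2; rewrite /grpalg_mul (big_fset_incl _ le1) /=; last first.
  move=> x _ /mcoeff_outdom fx.
  by rewrite big1 // => y _; rewrite fx mul0r monalgU0.
apply/eq_bigr=> x _; apply/big_fset_incl => // y _ /mcoeff_outdom ->.
by rewrite mulr0 monalgU0.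
Qed.

Lemma grpalg_mulDl : left_distributive grpalg_mul +%R.
Proof.
move=> f g h.
rewrite (grpalg_mulw (msuppD_le f g) (fsubset_refl _)).
rewrite (grpalg_mulw (fsubsetUl _ (msupp g)) (fsubset_refl (msupp h))).
rewrite (grpalg_mulw (fsubsetUr (msupp f) _) (fsubset_refl (msupp h))).
rewrite -big_split /=; apply/eq_bigr=> x _.
rewrite -big_split /=; apply/eq_bigr=> y _.
by rewrite mcoeffD mulrDl monalgUD.
Qed.

Lemma grpalg_mulDr : right_distributive grpalg_mul +%R.
Proof.
move=> h f g.
rewrite (grpalg_mulw (fsubset_refl _) (msuppD_le f g)).
rewrite (grpalg_mulw (fsubset_refl (msupp h)) (fsubsetUl _ (msupp g))).
rewrite (grpalg_mulw (fsubset_refl (msupp h)) (fsubsetUr (msupp f) _)).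
rewrite -big_split /=; apply/eq_bigr=> x _.
rewrite -big_split /=; apply/eq_bigr=> y _.
by rewrite mcoeffD mulrDr monalgUD.
Qed.

Lemma grpalg_mul0l : left_zero 0 grpalg_mul.
Proof. by move=> f; rewrite /grpalg_mul msupp0 big_seq_fset0. Qed.

Lemma grpalg_mul0r : right_zero 0 grpalg_mul.
Proof.
by move=> f; rewrite /grpalg_mul big1 // => x _; rewrite msupp0 big_seq_fset0.
Qed.

Lemma grpalg_mulUU a b x y :
  grpalg_mul << a *g x >> << b *g y >> = << a * b *g (x * y)%g >>.
Proof.
by rewrite (grpalg_mulw msuppU_le msuppU_le) !big_seq_fset1 !mcoeffUU.
Qed.

Lemma grpalg_ind (P : A -> Prop) :
  P 0 -> (forall f g, P f -> P g -> P (f + g)) ->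
  (forall a x, P << a *g x >>) -> forall f, P f.
Proof. by move=> P0 PD PU f; rewrite [f]monalgE; apply: big_ind. Qed.

Lemma grpalg_mulA : associative grpalg_mul.
Proof.
move=> f g h; elim/grpalg_ind: f => [|f1 f2 IH1 IH2|a x].
- by rewrite !grpalg_mul0l.
- by rewrite !grpalg_mulDl IH1 IH2.
elim/grpalg_ind: g => [|g1 g2 IH1 IH2|b y].
- by rewrite grpalg_mul0l !grpalg_mul0r grpalg_mul0l.
- by rewrite grpalg_mulDl !grpalg_mulDr grpalg_mulDl IH1 IH2.
elim/grpalg_ind: h => [|h1 h2 IH1 IH2|c z].
- by rewrite !grpalg_mul0r.
- by rewrite !grpalg_mulDr IH1 IH2.
by rewrite !grpalg_mulUU mulrA mulgA.
Qed.

Lemma grpalg_mul1l : left_id grpalg_one grpalg_mul.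
Proof.
elim/grpalg_ind => [|f g IHf IHg|a x]; first exact: grpalg_mul0r.
  by rewrite grpalg_mulDr IHf IHg.
by rewrite grpalg_mulUU mul1r mul1g.
Qed.

Lemma grpalg_mul1r : right_id grpalg_one grpalg_mul.
Proof.
elim/grpalg_ind => [|f g IHf IHg|a x]; first exact: grpalg_mul0l.
  by rewrite grpalg_mulDl IHf IHg.
by rewrite grpalg_mulUU mulr1 mulg1.
Qed.

Lemma grpalg_one_neq0 : grpalg_one != 0.
Proof. by rewrite monalgU_eq0 oner_eq0. Qed.

HB.instance Definition _ := GRing.Zmodule_isNzRing.Build A
  grpalg_mulA grpalg_mul1l grpalg_mul1r grpalg_mulDl grpalg_mulDr
  grpalg_one_neq0.

Lemma grpalgZU a b x : a *: (<< b *g x >> : A) = << a * b *g x >>.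
Proof. by apply/malgP=> y; rewrite mcoeffZ !mcoeffU mulrnAr. Qed.

Lemma grpalg_scaleAl a f g : a *: (f * g) = (a *: f) * g.
Proof.
rewrite -[f * g]/(grpalg_mul f g) -[a *: f * g]/(grpalg_mul (a *: f) g).
rewrite (grpalg_mulw (msuppZ_le a f) (fsubset_refl _)) scaler_sumr.
apply: eq_bigr => x _; rewrite scaler_sumr; apply: eq_bigr => y _.
by rewrite grpalgZU mcoeffZ mulrA.
Qed.

Lemma grpalg_scaleAr a f g : a *: (f * g) = f * (a *: g).
Proof.
rewrite -[f * g]/(grpalg_mul f g) -[f * _]/(grpalg_mul f (a *: g)).
rewrite (grpalg_mulw (fsubset_refl _) (msuppZ_le a g)) scaler_sumr.
apply: eq_bigr => x _; rewrite scaler_sumr; apply: eq_bigr => y _.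
by rewrite grpalgZU mcoeffZ mulrCA.
Qed.

HB.instance Definition _ := GRing.Lmodule_isLalgebra.Build k A grpalg_scaleAl.
HB.instance Definition _ := GRing.Lalgebra_isAlgebra.Build k A grpalg_scaleAr.

End GroupAlgebra.

Section CyclicCohomology.
Variables (k : comNzRingType) (A : algType k).

(* Arbitrary functions of n + 1 arguments, multilinear or not. *)
Definition functional n : Type := ('I_n.+1 -> A) -> k^o.

HB.instance Definition _ n := GRing.Lmodule.on (functional n).

Definition multilinear n (phi : functional n) : Prop :=
  forall (a : 'I_n.+1 -> A) (i : 'I_n.+1),
    scalar (fun x : A => phi (@dfwith _ (fun=> A) a i x)).

(* [ord_pred] is the predecessor modulo n + 1, so the argument of phi on the
   left is (a_n, a_0, ..., a_{n-1}). *)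
Definition cyclic n (phi : functional n) : Prop :=
  forall a : 'I_n.+1 -> A,
    phi (fun j => a (ord_pred j)) = (-1) ^+ n * phi a.

Definition cyclic_cochain n (phi : functional n) : Prop :=
  multilinear phi /\ cyclic phi.

(* (a_0, ..., a_i a_{i+1}, ..., a_{n+1}), for 0 <= i <= n *)
Definition inner_face n (i : 'I_n.+1) (a : 'I_n.+2 -> A) : 'I_n.+1 -> A :=
  fun j => if (j < i)%N then a (widen_ord (leqnSn _) j)
           else if j == i then a (widen_ord (leqnSn _) i) * a (lift ord0 i)
           else a (lift ord0 j).

(* (a_{n+1} a_0, a_1, ..., a_n) *)
Definition outer_face n (a : 'I_n.+2 -> A) : 'I_n.+1 -> A :=
  fun j => if j == ord0 then a ord_max * a ord0
           else a (widen_ord (leqnSn _) j).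

Definition hochschild n (phi : functional n) : functional n.+1 :=
  fun a => \sum_(i < n.+1) (-1) ^+ i * phi (inner_face i a)
           + (-1) ^+ n.+1 * phi (outer_face a).

Definition is_cocycle n (phi : functional n) : Prop :=
  cyclic_cochain phi /\ hochschild phi = 0.

Definition is_coboundary n : functional n -> Prop :=
  if n is m.+1 return functional n -> Prop then
    fun phi => exists2 psi : functional m,
      cyclic_cochain psi & phi = hochschild psi
  else fun phi => phi = 0.

Lemma hochschildP n c (phi psi : functional n) :
  hochschild (c *: phi + psi) = c *: hochschild phi + hochschild psi.
Proof.
apply/funext=> a; rewrite /hochschild !fctE.
rewrite -[RHS]/(c * (_ + _) + (_ + _)) [c * _]mulrDr addrACA mulr_sumr.
rewrite -big_split /=.
congr (_ + _); last by rewrite mulrDr mulrCA.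
by apply: eq_bigr => i _; rewrite mulrDr mulrCA.
Qed.

Lemma hochschild0 n : hochschild (0 : functional n) = 0.
Proof.
by have := @hochschildP n (-1) 0 0; rewrite scaler0 addr0 scaleN1r addNr.
Qed.

Lemma cyclic_cochain0 n : cyclic_cochain (0 : functional n).
Proof.
have phi0 a : (0 : functional n) a = 0 by [].
by split=> [a i c x y|a]; rewrite !phi0 mulr0 ?addr0.
Qed.

Lemma cyclic_cochainP n c (phi psi : functional n) :
  cyclic_cochain phi -> cyclic_cochain psi -> cyclic_cochain (c *: phi + psi).
Proof.
move=> [mphi cphi] [mpsi cpsi].
have lcE a : (c *: phi + psi) a = c * phi a + psi a by [].
split=> [a i d x y|a]; rewrite !lcE.
  by rewrite mphi mpsi !mulrDr addrACA mulrCA.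
by rewrite cphi cpsi mulrDr mulrCA.
Qed.

Definition cocycle_pred n : {pred functional n} := fun phi => `[< is_cocycle phi >].

Lemma cocycle_submod_closed n : submod_closed (@cocycle_pred n).
Proof.
split=> [|c phi psi /asboolP[phiC bphi] /asboolP[psiC bpsi]]; apply/asboolP.
  by split; [exact: cyclic_cochain0 | exact: hochschild0].
split; first exact: cyclic_cochainP.
by rewrite hochschildP bphi bpsi scaler0 addr0.
Qed.

HB.instance Definition _ n := GRing.isSubmodClosed.Build k (functional n)
  (@cocycle_pred n) (@cocycle_submod_closed n).

Record cocycle n := Cocycle {
  cocycle_val :> functional n;
  _ : cocycle_val \in @cocycle_pred n
}.

HB.instance Definition _ n := [isSub for @cocycle_val n].
HB.instance Definition _ n := [Choice of cocycle n by <:].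
HB.instance Definition _ n := [SubChoice_isSubLmodule of cocycle n by <:].

Definition coboundary_pred n : {pred cocycle n} :=
  fun z => `[< is_coboundary (cocycle_val z) >].

Lemma coboundary_submod_closed n : submod_closed (@coboundary_pred n).
Proof.
case: n => [|n]; split; rewrite ?unfold_in.
- exact/asboolP.
- move=> c x y /asboolP /= x0 /asboolP /= y0; apply/asboolP => /=.
  by rewrite x0 y0 scaler0 addr0.
- apply/asboolP; exists 0; [exact: cyclic_cochain0 | by rewrite hochschild0].
- move=> c x y /asboolP[phi phiC xE] /asboolP[psi psiC yE]; apply/asboolP.
  exists (c *: phi + psi); first exact: cyclic_cochainP.
  by rewrite hochschildP -xE -yE.
Qed.

HB.instance Definition _ n := GRing.isSubmodClosed.Build k (cocycle n)
  (@coboundary_pred n) (@coboundary_submod_closed n).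

Definition HC n : Type := quotmod (@coboundary_pred n).

HB.instance Definition _ n := GRing.Lmodule.on (HC n).

End CyclicCohomology.

(* The semidirect product of Z by Z_2 acting by inversion, the pair (m, s)
   standing for S^m e^s. *)
Definition dihedral : Type := (int * bool)%type.

HB.instance Definition _ := Choice.on dihedral.

Definition Z2_act (s : bool) (m : int) : int := if s then - m else m.

Definition dihedral_mul (x y : dihedral) : dihedral :=
  (x.1 + Z2_act x.2 y.1, x.2 (+) y.2).

Definition dihedral_inv (x : dihedral) : dihedral :=
  (- Z2_act x.2 x.1, x.2).

Lemma dihedral_mulA : associative dihedral_mul.
Proof.
move=> [m s] [n t] [p u]; congr (_, _); rewrite /= ?addbA //.
by case: s t => [] [] /=; rewrite ?opprD ?opprK addrA.
Qed.

Lemma dihedral_mul1g : left_id ((0, false) : dihedral) dihedral_mul.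
Proof. by move=> [m s]; rewrite /dihedral_mul /= add0r. Qed.

Lemma dihedral_mulg1 : right_id ((0, false) : dihedral) dihedral_mul.
Proof. by move=> [m []]; rewrite /dihedral_mul /= ?oppr0 addr0. Qed.

Lemma dihedral_mulVg :
  left_inverse ((0, false) : dihedral) dihedral_inv dihedral_mul.
Proof. by move=> [m []]; rewrite /dihedral_mul /= ?opprK ?subrr ?addNr. Qed.

Lemma dihedral_mulgV :
  right_inverse ((0, false) : dihedral) dihedral_inv dihedral_mul.
Proof. by move=> [m []]; rewrite /dihedral_mul /= ?opprK subrr. Qed.

HB.instance Definition _ := isGroup.Build dihedral dihedral_mulA
  dihedral_mul1g dihedral_mulg1 dihedral_mulVg dihedral_mulgV.

Fact dihedral_relations (S := (1, false) : dihedral) (e := (0, true) : dihedral) :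
  (e * e = 1 /\ e * S * e = S^-1)%g.
Proof. by []. Qed.

(* Main.v *)
Require Import Defs.
From HB Require Import structures.
From mathcomp Require Import all_boot all_order all_algebra finmap.
From mathcomp Require Import boolp classical_sets functions reals complex.
From mathcomp Require Import generic_quotient monalg.
From mathcomp Require Import ring zify.

(** Cyclic cochains on a group algebra are computed in homogeneous
    coordinates. The value of a multilinear functional on (g_0, ..., g_n) is
    written F(x; h_0, ..., h_n), where
      g_0 = h_n^-1 x h_0   and   g_i = h_(i-1)^-1 h_i  for i > 0;
    such F are exactly the functions invariant under
    (x; h) |-> (g x g^-1; g h), see [cochain_of_inj] and
    [cochain_of_functional_of]. The product g_0 ... g_n is conjugate to x, the
    Hochschild coboundary becomes the alternating sum over the deletions of one
    h_i ([cochain_of_hochschild]), and the cyclic operator becomes the rotation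
    of h that multiplies by x the entry it carries around ([cyclic_of_cochain]).
    The cohomology thus splits over the conjugacy classes of x. For the
    infinite dihedral group these are 1, the two classes of reflections, and
    the classes of the translations S^p, p >= 1.

    Three facts give the answer.

    - The Cayley graph of the group for the generators e and S e is a line, so
      an antisymmetric function on its edges has a potential, unique up to a
      constant and therefore compatible with left translations up to a constant.
      This yields an equivariant homotopy which shows that Hochschild cocycles
      of degree at least 2 are coboundaries ([hochschild_exact]).

    - Connes' periodicity is the chase in the cyclic bicomplex, done by hand: a
      cyclic cocycle of degree m + 2 which is a Hochschild coboundary produces
      a cyclic cocycle of degree m ([periodicity_descend]), and it is a cyclic
      coboundary as soon as the latter is one ([periodicity_lift]). The rows
      are exact because the characteristic is 0 ([cyc_primP]), the columns of
      truncated coboundaries because an entry can be repeated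
      ([tail_cobd_dup_head]).

    - In degree 0 a cocycle is a class function. In degree 1 every cyclic
      cocycle is a coboundary ([closed1_exact], [cyclic1_commuting]). In degree
      2 a class function tau, seen as the cocycle tau(a_0 a_1 a_2), is a cyclic
      coboundary when tau lives on the translations S^p, p <> 0
      ([displacementP]).

    By induction on the degree the odd groups vanish, and in even positive
    degree every class is that of tau(a_0 ... a_n), where tau is a class
    function supported on 1 and the reflections, hence given by three numbers.
    These numbers can be read off the class: if p is an idempotent and psi is
    cyclic of odd degree, then psi(p, ..., p) = - psi(p, ..., p) = 0, so that
    evaluation at (p, ..., p) kills even coboundaries
    ([hochschild_idempotent]); it maps tau(a_0 ... a_n) to tau(p), and the
    idempotents 1, (1 + e)/2 and (1 + S e)/2 determine tau. *)

Set Implicit Arguments.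
Unset Strict Implicit.
Unset Printing Implicit Defensive.

Import GRing.Theory Num.Theory.

Local Open Scope ring_scope.
Local Open Scope quotient_scope.

(** * Alternating sums of deletions and twisted rotations *)

Section Simplicial.
Variables (k : comNzRingType) (T : Type).
Implicit Types (f g : seq T -> k) (s t : seq T).

(** The simplicial coboundary, for all degrees at once; [alt_delE] is the usual
    formula. The recursion on the first entry turns most identities into
    two-line inductions. *)
Fixpoint alt_del f s : k :=
  if s is y :: t then f t - alt_del (fun u => f (y :: u)) t else 0.

Lemma alt_delB f g s :
  alt_del (fun u => f u - g u) s = alt_del f s - alt_del g s.
Proof.
by elim: s f g => [|y s IH] f g /=; [rewrite subr0 | rewrite IH; ring].
Qed.

Lemma alt_delD f g s :
  alt_del (fun u => f u + g u) s = alt_del f s + alt_del g s.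
Proof.
by elim: s f g => [|y s IH] f g /=; [rewrite addr0 | rewrite IH; ring].
Qed.

Lemma alt_delZ c f s : alt_del (fun u => c * f u) s = c * alt_del f s.
Proof. by elim: s f => [|y s IH] f /=; [rewrite mulr0 | rewrite IH; ring]. Qed.

Lemma eq_alt_del n f g s : (forall u, size u = n -> f u = g u) ->
  size s = n.+1 -> alt_del f s = alt_del g s.
Proof.
elim: s n f g => //= y s IH n f g fg [sn]; congr (_ - _); first exact: fg.
case: n fg sn => [|n] fg sn; first by case: s sn {IH}.
by apply: (IH n) => // u un; apply: fg; rewrite /= un.
Qed.

Lemma eqf_alt_del f g s : f =1 g -> alt_del f s = alt_del g s.
Proof.
by elim: s f g => //= y s IH f g fg; rewrite fg (IH _ (fun u => g (y :: u))).
Qed.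

Lemma alt_del_alt_del f s : alt_del (alt_del f) s = 0.
Proof.
by elim: s f => //= y s IH f; rewrite alt_delB IH subr0 subrr.
Qed.

Lemma alt_del_const c s : alt_del (fun=> c) s = if odd (size s) then c else 0.
Proof.
elim: s => //= y s ->; case: (odd _); rewrite ?subrr ?subr0 //=.
Qed.

Lemma alt_del_rcons f s z :
  alt_del f (rcons s z) =
  alt_del (fun u => f (rcons u z)) s + (-1) ^+ size s * f s.
Proof.
elim: s f => [|y s IH] f /=; first by rewrite mul1r subr0 add0r.
by rewrite IH exprS; ring.
Qed.

Definition del i s := take i s ++ drop i.+1 s.

Lemma size_del i s : (i < size s)%N -> size (del i s) = (size s).-1.
Proof.
move=> lis; rewrite size_cat size_take size_drop lis.
by case: (size s) lis => //= m lim; rewrite subSS subnKC.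
Qed.

Lemma alt_delE f s : alt_del f s = \sum_(i < size s) (-1) ^+ i * f (del i s).
Proof.
elim: s f => [|y s IH] f /=; first by rewrite big_ord0.
rewrite big_ord_recl mul1r /del /= drop0 IH; congr (_ + _).
by rewrite -sumrN; apply: eq_bigr => i _; rewrite /bump /= exprS; ring.
Qed.

End Simplicial.

Section TwistedRotation.
Variables (G : groupType).
Implicit Types (x y : G) (s t : seq G).

(** The rotation of (h_0, ..., h_n) after which, in the coordinates g_i, the
    sequence is (g_1, ..., g_n, g_0). *)
Definition trot x s := if s is y :: t then rcons t (x * y)%g else [::].

Lemma size_trot x s : size (trot x s) = size s.
Proof. by case: s => //= y s; rewrite size_rcons. Qed.

Lemma size_iter_trot x j s : size (iter j (trot x) s) = size s.
Proof. by elim: j => //= j IH; rewrite size_trot. Qed.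

Lemma iter_trot x i s : (i <= size s)%N ->
  iter i (trot x) s = drop i s ++ [seq (x * y)%g | y <- take i s].
Proof.
elim: i => [|i IH] lis; first by rewrite take0 drop0 cats0.
case: s IH lis => [|y0 s0] // ; set s := y0 :: s0 => IH lis.
rewrite iterS IH 1?ltnW //  (drop_nth y0) // (take_nth y0) //=.
by rewrite map_rcons rcons_cat.
Qed.

Lemma iter_trot_size x s : iter (size s) (trot x) s = [seq (x * y)%g | y <- s].
Proof. by rewrite iter_trot // drop_size take_size. Qed.

(** Every deletion is a deletion of the first entry up to rotation; this is
    what relates the coboundary to the cyclic norm in [cobd_cyc_norm]. *)
Lemma iter_trot_del x i s : (i < size s)%N ->
  iter i (trot x) (del i s) = behead (iter i (trot x) s).
Proof.
move=> lis; have lid : (i <= size (del i s))%N.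
  by rewrite size_del //; case: (size s) lis.
rewrite (iter_trot _ lid) (iter_trot _ (ltnW lis)).
case: s lis lid => // y0 s0; set s := y0 :: s0 => lis lid.
rewrite [in RHS](drop_nth y0) //= /del take_cat drop_cat size_take.
rewrite lis ltnn subnn.
by rewrite take0 drop0 cats0.
Qed.

Lemma trot_conj g x s :
  trot (g * x * g^-1)%g [seq (g * y)%g | y <- s]
  = [seq (g * y)%g | y <- trot x s].
Proof. by case: s => //= y s; rewrite map_rcons !mulgA mulgVK. Qed.

Lemma iter_trot_conj g x j s :
  iter j (trot (g * x * g^-1)%g) [seq (g * y)%g | y <- s]
  = [seq (g * y)%g | y <- iter j (trot x) s].
Proof. by elim: j => //= j ->; rewrite trot_conj. Qed.

End TwistedRotation.

(** * The cyclic bicomplex in homogeneous coordinates *)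

Section Cochains.
Variables (k : numFieldType) (G : groupType).
Implicit Types (F H : G -> seq G -> k) (x y : G) (s t : seq G) (m n : nat).

Definition equivariant F :=
  forall g x s, F (g * x * g^-1)%g [seq (g * y)%g | y <- s] = F x s.

(** A cochain is a function on sequences of every length; its part of degree n
    lives on the sequences of length n + 1. *)
Definition eq_deg n F H := forall x s, size s = n -> F x s = H x s.

Definition cobd F : G -> seq G -> k := fun x => alt_del (F x).
(** Connes' signed cyclic operator: cyclic cochains are its fixed points. *)
Definition cyc F : G -> seq G -> k :=
  fun x s => (-1) ^+ (size s).-1 * F x (trot x s).
(** The coboundary without the deletion of the first entry, the counterpart
    of the operator written b' in cyclic theory. *)
Definition tail_cobd F : G -> seq G -> k :=
  fun x s => if s is y :: t then - alt_del (fun u => F x (y :: u)) t else 0.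
(** Up to sign, a contraction of [tail_cobd]. It is equivariant because the new
    entry repeats the first one, and it works because [tail_cobd] never deletes
    the first entry. *)
Definition dup_head F : G -> seq G -> k :=
  fun x s => if s is y :: t then F x (y :: y :: t) else 0.
Definition cyc_norm F : G -> seq G -> k := fun x s =>
  \sum_(j < size s) (-1) ^+ (size s).-1 ^+ j * F x (iter j (trot x) s).

Lemma eq_deg_cobd n F H : eq_deg n F H -> eq_deg n.+1 (cobd F) (cobd H).
Proof. by move=> FH x s; apply: eq_alt_del => u; apply: FH. Qed.

Lemma eq_deg_cyc n F H : eq_deg n F H -> eq_deg n (cyc F) (cyc H).
Proof. by move=> FH x s sn; rewrite /cyc FH // size_trot. Qed.

Lemma eq_deg_cyc_norm n F H :
  eq_deg n F H -> eq_deg n (cyc_norm F) (cyc_norm H).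
Proof.
move=> FH x s sn; apply: eq_bigr => j _; rewrite FH //.
by rewrite size_iter_trot.
Qed.

Lemma eq_deg_tail_cobd n F H :
  eq_deg n F H -> eq_deg n.+1 (tail_cobd F) (tail_cobd H).
Proof.
move=> FH x [//|y s] /= [sn]; congr (- _).
case: n FH sn => [|n] FH sn; first by case: s sn.
by apply: (@eq_alt_del _ _ n) => // u un; apply: FH; rewrite /= un.
Qed.

Lemma cobd_tail_cobd F x y s :
  cobd F x (y :: s) = F x s + tail_cobd F x (y :: s).
Proof. by []. Qed.

(** The rotation turns deletion of the first entry into deletion of the last
    one, whose sign cancels the one carried by [cyc]. *)
Lemma cyc_cobd F x y s :
  cyc (cobd F) x (y :: s) = F x s + tail_cobd (cyc F) x (y :: s).
Proof.
rewrite /cyc /cobd /= alt_del_rcons mulrDr mulrA -exprMn mulrNN mulr1 expr1n.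
rewrite mul1r addrC; congr (_ + _); rewrite /tail_cobd -[RHS]mulN1r -!alt_delZ.
case: s => [|z s]; first by rewrite /= ?mulr0 ?oppr0.
apply: (@eq_alt_del _ _ (size s)) => // u -> /=; rewrite exprS; ring.
Qed.

Lemma sub_cyc_cobd F x y s :
  cobd F x (y :: s) - cyc (cobd F) x (y :: s)
  = tail_cobd (fun x s => F x s - cyc F x s) x (y :: s).
Proof. by rewrite cyc_cobd cobd_tail_cobd /tail_cobd alt_delB; ring. Qed.

Lemma tail_cobd_dup_head F x y s :
  tail_cobd (dup_head F) x (y :: s) + dup_head (tail_cobd F) x (y :: s)
  = - F x (y :: s).
Proof. by rewrite /=; ring. Qed.

Lemma tail_cobd_tail_cobd F x s : tail_cobd (tail_cobd F) x s = 0.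
Proof.
case: s => //= y s.
rewrite -[RHS](@alt_del_alt_del k G (fun u => F x (y :: u)) s).
by rewrite -[LHS]mulN1r -alt_delZ; apply: eqf_alt_del => u /=; ring.
Qed.

End Cochains.

Section Norm.
Variables (k : numFieldType) (G : groupType).
Implicit Types (F H : G -> seq G -> k) (x y : G) (s t : seq G) (m n : nat).

(** Equivariance under x itself: this is why a full turn of [trot], which
    multiplies all the entries by x, acts trivially. *)
Lemma equivariant_self F x s : equivariant F ->
  F x [seq (x * y)%g | y <- s] = F x s.
Proof. by move=> eF; rewrite -{1}[x](mulgK x) eF. Qed.

Lemma sign_period n : ((-1) ^+ n.-1 : k) ^+ n = 1.
Proof.
rewrite -exprM -signr_odd oddM; case: n => //= n.
by rewrite andbN.
Qed.

Lemma signK n : ((-1) ^+ n : k) * (-1) ^+ n = 1.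
Proof. by rewrite -exprMn mulrNN mulr1 expr1n. Qed.

Lemma cyc_norm_comp_trot F x s : equivariant F ->
  cyc_norm (fun x s => F x (trot x s)) x s =
  (-1) ^+ (size s).-1 * cyc_norm F x s.
Proof.
move=> eF; rewrite /cyc_norm; set e := (-1) ^+ _; set m := size s.
pose a j := e ^+ j * F x (iter j (trot x) s).
have aS : \sum_(j < m) a j = \sum_(j < m) a j.+1.
  apply: (@addrI _ (a 0)); rewrite -(big_ord_recl m a) big_ord_recr /= addrC.
  congr (_ + _).
  by rewrite /a sign_period iter_trot_size equivariant_self // mul1r.
rewrite -/(a _) in aS *; rewrite aS mulr_sumr; apply: eq_bigr => j _.
by rewrite /a /= exprS !mulrA signK mul1r.
Qed.

Lemma cyc_norm_trot F x s : equivariant F ->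
  cyc_norm F x (trot x s) = (-1) ^+ (size s).-1 * cyc_norm F x s.
Proof.
move=> eF; rewrite -cyc_norm_comp_trot // /cyc_norm size_trot.
by apply: eq_bigr => j _; rewrite -iterSr.
Qed.

Lemma cyc_cyc_norm F x s :
  equivariant F -> cyc (cyc_norm F) x s = cyc_norm F x s.
Proof. by move=> eF; rewrite /cyc cyc_norm_trot // mulrA signK mul1r. Qed.

Lemma cyc_norm_iter_trot F x i s : equivariant F ->
  cyc_norm F x (iter i (trot x) s) = (-1) ^+ (size s).-1 ^+ i * cyc_norm F x s.
Proof.
move=> eF; elim: i => [|i IH]; first by rewrite mul1r.
by rewrite iterS cyc_norm_trot // size_iter_trot IH exprS mulrA.
Qed.

Lemma cyc_norm_comp_iter_trot F x i s : equivariant F ->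
  cyc_norm (fun x s => F x (iter i (trot x) s)) x s =
  (-1) ^+ (size s).-1 ^+ i * cyc_norm F x s.
Proof.
move=> eF; rewrite -cyc_norm_iter_trot // /cyc_norm size_iter_trot.
by apply: eq_bigr => j _; rewrite -!iterD addnC.
Qed.

Lemma cyc_norm_cyc F x s :
  equivariant F -> cyc_norm (cyc F) x s = cyc_norm F x s.
Proof.
move=> eF; apply: etrans (_ : (-1) ^+ (size s).-1 *
  cyc_norm (fun x s => F x (trot x s)) x s = _); last first.
  by rewrite cyc_norm_comp_trot // mulrA signK mul1r.
rewrite /cyc_norm mulr_sumr; apply: eq_bigr => j _.
by rewrite /cyc size_iter_trot; ring.
Qed.

Lemma cyc_normB F H x s :
  cyc_norm (fun x s => F x s - H x s) x s = cyc_norm F x s - cyc_norm H x s.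
Proof. by rewrite /cyc_norm -sumrB; apply: eq_bigr => j _; rewrite mulrBr. Qed.

Lemma cyc_norm_id n F : eq_deg n (cyc F) F ->
  eq_deg n (cyc_norm F) (fun x s => n%:R * F x s).
Proof.
move=> lF x s sn; rewrite /cyc_norm mulr_natl -sn.
rewrite -[size s in RHS]card_ord -sumr_const.
apply: eq_bigr => -[j /= _] _.
elim: j => [|j IH]; first by rewrite mul1r.
rewrite -{}IH -(lF x (iter j _ s)) ?size_iter_trot // /cyc size_iter_trot.
by rewrite iterS exprS; ring.
Qed.

(** Solves H - cyc H = F when the cyclic norm of F is 0: the coefficients j
    make the sum telescope, and a full turn leaves a multiple of F. *)
Definition cyc_prim F : G -> seq G -> k := fun x s => - (size s)%:R^-1 *
  \sum_(j < size s) j%:R * ((-1) ^+ (size s).-1 ^+ j * F x (iter j (trot x) s)).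

Lemma cyc_primP F x s : equivariant F -> (0 < size s)%N ->
  cyc_prim F x s - cyc (cyc_prim F) x s =
  F x s - (size s)%:R^-1 * cyc_norm F x s.
Proof.
move=> eF s0; rewrite /cyc_prim /cyc size_trot.
set e := (-1) ^+ _; set m := size s.
have m0 : m%:R != 0 :> k by rewrite pnatr_eq0 -lt0n.
pose a j := e ^+ j * F x (iter j (trot x) s).
pose A := \sum_(j < m) j%:R * a j.
have am : a m = F x s.
  by rewrite /a sign_period iter_trot_size equivariant_self // mul1r.
(* Summation by parts of \sum_j j a_j. *)
have AE : A + m%:R * a m = \sum_(j < m) j%:R * a j.+1 + cyc_norm F x s.
  rewrite -(big_ord_recr m (fun j => j%:R * a j)) big_ord_recl /= mul0r add0r.
  have -> : cyc_norm F x s = \sum_(j < m) a j.+1.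
    apply: (@addrI _ (a 0)); rewrite -(big_ord_recl m a) big_ord_recr /=.
    by rewrite am addrC; congr (_ + _); rewrite /a mul1r.
  rewrite -big_split; apply: eq_bigr => j _ /=.
  by rewrite -[in LHS]natr1 mulrDl mul1r.
have -> : \sum_(j < m) j%:R * (e ^+ j * F x (iter j (trot x) (trot x s)))
    = e * \sum_(j < m) j%:R * a j.+1.
  rewrite mulr_sumr; apply: eq_bigr => j _.
  rewrite /a exprS iterSr -[LHS]mul1r -(signK (size s).-1) -/e; ring.
have -> : \sum_(j < m) j%:R * a j.+1 = A + m%:R * F x s - cyc_norm F x s.
  by rewrite -am AE addrK.
transitivity (- m%:R^-1 * A +
  e * e * m%:R^-1 * (A + m%:R * F x s - cyc_norm F x s)).
  by rewrite /A; ring.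
by rewrite signK; field.
Qed.

Lemma tail_cobdE F x s n : size s = n.+1 ->
  tail_cobd F x s = \sum_(i < n) (-1) ^+ i.+1 * F x (del i.+1 s).
Proof.
case: s => //= y s [<-]; rewrite alt_delE -sumrN; apply: eq_bigr => i _.
by rewrite exprS /del /=; ring.
Qed.

(** Both sides are sums over all pairs of a rotation and a deletion: with D the
    deletion of the first entry, they are the norm of D applied to the norm
    of F. On the right the deletions at positions 1, ..., n, combined with the
    rotations that bring them to the front, produce the norm of F in its own
    degree. *)
Lemma cobd_cyc_norm F x s :
  equivariant F -> cobd (cyc_norm F) x s = cyc_norm (tail_cobd F) x s.
Proof.
move=> eF; case sE : (size s) => [|n].
  by rewrite (size0nil sE) /cyc_norm big_ord0.
(* Write each deletion at i + 1 as a rotation, a deletion of the first entry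
   and the complementary rotation. *)
have -> : cyc_norm (tail_cobd F) x s = \sum_(i < n) (-1) ^+ i.+1 *
    cyc_norm (fun x r => F x (iter (n - i.+1) (trot x)
                            (behead (iter i.+1 (trot x) r)))) x s.
  rewrite {1}/cyc_norm; under eq_bigr => j _.
    rewrite (@tail_cobdE F x _ n) ?size_iter_trot // mulr_sumr.
    over.
  rewrite exchange_big; apply: eq_bigr => i _ /=.
  rewrite mulr_sumr; apply: eq_bigr => j _; rewrite mulrCA; congr (_ * (_ * _)).
  have sr : size (iter j (trot x) s) = n.+1 by rewrite size_iter_trot.
  move: (iter j (trot x) s) sr => r sr.
  have ir : (i.+1 < size r)%N by rewrite sr ltnS.
  have sd : size (del i.+1 r) = n by rewrite size_del // sr.
  rewrite -iterS -(iter_trot_del _ ir) -iterD subnK // -{2}sd iter_trot_size.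
  by rewrite equivariant_self.
have eH i : equivariant (fun x r => F x (iter (n - i) (trot x) (behead r))).
  by move=> g z r; rewrite behead_map iter_trot_conj eF.
under eq_bigr => i _ do
  rewrite (cyc_norm_comp_iter_trot _ _ _ (eH i.+1)) sE /cyc_norm sE.
rewrite /cobd alt_delE sE.
have sn (i : 'I_n) : (-1) ^+ n = - (-1) ^+ n.-1 :> k.
  by rewrite -[in LHS](ltn_predK (ltn_ord i)) exprS mulN1r.
transitivity (\sum_(l < n.+1) \sum_(i < n) (-1) ^+ n ^+ l *
   ((-1) ^+ n.-1 ^+ i.+1 *
    F x (iter (n - i.+1) (trot x) (behead (iter l (trot x) s))))).
  apply: eq_bigr => l _; have ls : (l < size s)%N by rewrite sE.
  have {1}-> : cyc_norm F x (del l s) =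
      (-1) ^+ n.-1 ^+ l * cyc_norm F x (iter l (trot x) (del l s)).
    rewrite cyc_norm_iter_trot // size_del // sE mulrA.
    by rewrite -exprMn signK expr1n mul1r.
  rewrite iter_trot_del // {1}/cyc_norm size_behead size_iter_trot sE /=.
  (* The complementary rotation has n - (i + 1) steps. *)
  rewrite (reindex_inj rev_ord_inj) mulrA mulr_sumr.
  apply: eq_bigr => i _ /=.
  rewrite (sn i) -exprMn mulN1r; congr (_ * (_ * _)).
  have e0 : (-1) ^+ n.-1 ^+ i.+1 != 0 :> k by rewrite expf_neq0 ?signr_eq0.
  apply: (mulIf e0); rewrite -exprD subnK // sign_period.
  by rewrite -exprMn signK expr1n.
rewrite exchange_big; apply: eq_bigr => i _.
rewrite mulrA -exprMn mulN1r [n.+1.-1]/= {2}(sn i) opprK mulr_sumr.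
by apply: eq_bigr => l _; rewrite mulrCA.
Qed.

End Norm.

(** * Periodicity *)

Section Periodicity.
Variables (k : numFieldType) (G : groupType).
Implicit Types (F H : G -> seq G -> k) (x y : G) (s t : seq G) (m n : nat).

Lemma alt_del_map (T : Type) (h : T -> T) (f : seq T -> k) (s : seq T) :
  alt_del f (map h s) = alt_del (fun u => f (map h u)) s.
Proof. by elim: s f => //= y s IH f; rewrite IH. Qed.

Lemma equivariant_cobd F : equivariant F -> equivariant (cobd F).
Proof.
move=> eF g x s; rewrite /cobd alt_del_map.
by apply: eqf_alt_del => u; apply: eF.
Qed.

Lemma equivariant_cyc F : equivariant F -> equivariant (cyc F).
Proof. by move=> eF g x s; rewrite /cyc size_map trot_conj eF. Qed.

Lemma equivariant_tail_cobd F : equivariant F -> equivariant (tail_cobd F).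
Proof.
move=> eF g x [|y s] //=; rewrite alt_del_map; congr (- _).
by apply: eqf_alt_del => u; rewrite -[RHS](eF g).
Qed.

Lemma equivariant_dup_head F : equivariant F -> equivariant (dup_head F).
Proof. by move=> eF g x [|y s] //=; rewrite -[RHS](eF g). Qed.

Lemma equivariant_cyc_norm F : equivariant F -> equivariant (cyc_norm F).
Proof.
move=> eF g x s; rewrite /cyc_norm size_map; apply: eq_bigr => j _.
by rewrite iter_trot_conj eF.
Qed.

Lemma equivariant_cyc_prim F : equivariant F -> equivariant (cyc_prim F).
Proof.
move=> eF g x s; rewrite /cyc_prim size_map; congr (_ * _).
apply: eq_bigr => j _.
by rewrite iter_trot_conj eF.
Qed.

Lemma equivariantB F H : equivariant F -> equivariant H ->
  equivariant (fun x s => F x s - H x s).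
Proof. by move=> eF eH g x s; rewrite eF eH. Qed.

Lemma equivariantZ c F : equivariant F -> equivariant (fun x s => c * F x s).
Proof. by move=> eF g x s; rewrite eF. Qed.

Lemma cycB F H x s :
  cyc (fun x s => F x s - H x s) x s = cyc F x s - cyc H x s.
Proof. by rewrite /cyc mulrBr. Qed.

Lemma tail_cobdB F H x s :
  tail_cobd (fun x s => F x s - H x s) x s = tail_cobd F x s - tail_cobd H x s.
Proof. by case: s => [|y s] /=; rewrite ?subr0 // alt_delB; ring. Qed.

Lemma tail_cobdZ c F x s :
  tail_cobd (fun x s => c * F x s) x s = c * tail_cobd F x s.
Proof. by case: s => [|y s] /=; rewrite ?mulr0 // alt_delZ; ring. Qed.

(** H need not be cyclic, but H - cyc H is killed by the truncated coboundary,
    since F is cyclic; it thus has a primitive T, and the norm of T is a cyclic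
    cocycle two degrees below F. *)
Lemma periodicity_descend m F H : equivariant H ->
  eq_deg m.+3 (cyc F) F -> eq_deg m.+3 F (cobd H) ->
  exists T, [/\ equivariant T,
    eq_deg m.+2 (fun x s => H x s - cyc H x s) (tail_cobd T),
    eq_deg m.+1 (cyc (cyc_norm T)) (cyc_norm T) &
    eq_deg m.+2 (cobd (cyc_norm T)) (fun _ _ => 0)].
Proof.
move=> eH cF FH; pose D x s := H x s - cyc H x s.
have eD : equivariant D by apply/equivariantB/equivariant_cyc.
exists (fun x s => -1 * dup_head D x s).
have eT : equivariant (fun x s => -1 * dup_head D x s).
  exact/equivariantZ/equivariant_dup_head.
have DT : eq_deg m.+2 D (tail_cobd (fun x s => -1 * dup_head D x s)).
  move=> x [//|y s] sm; have := tail_cobd_dup_head D x y s.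
  have -> : dup_head (tail_cobd D) x (y :: s) = 0.
    rewrite /dup_head -/(tail_cobd _ _ _) -sub_cyc_cobd.
    have sm3 : size (y :: y :: s) = m.+3 by rewrite -sm.
    by rewrite -(eq_deg_cyc FH) // -FH // cF // subrr.
  by rewrite addr0 tail_cobdZ => ->; rewrite mulN1r opprK.
split=> // [x s _|x s sm]; first by rewrite cyc_cyc_norm.
rewrite cobd_cyc_norm // -(eq_deg_cyc_norm DT) //.
by rewrite cyc_normB cyc_norm_cyc // subrr.
Qed.

(** The hypothesis on E says that the class of the norm of T is trivial. Then
    T - tail_cobd E has norm 0, hence is of the form Z - cyc Z, and subtracting
    cobd Z from H makes it cyclic while keeping its coboundary. *)
Lemma periodicity_lift m F H T E :
    equivariant H -> equivariant T -> equivariant E ->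
    eq_deg m.+3 F (cobd H) ->
    eq_deg m.+2 (fun x s => H x s - cyc H x s) (tail_cobd T) ->
    eq_deg m.+1 (cyc_norm T) (cyc_norm (tail_cobd E)) ->
  exists H', [/\ equivariant H', eq_deg m.+2 (cyc H') H' &
    eq_deg m.+3 F (cobd H')].
Proof.
move=> eH eT eE FH HT TE.
pose D x s := T x s - tail_cobd E x s.
have eD : equivariant D by apply/equivariantB/equivariant_tail_cobd.
have ez : equivariant (cyc_prim D) by apply: equivariant_cyc_prim.
have Dz : eq_deg m.+1 D (fun x s => cyc_prim D x s - cyc (cyc_prim D) x s).
  move=> x s sm; rewrite cyc_primP ?sm //.
  by rewrite [cyc_norm D _ _]cyc_normB TE // subrr mulr0 subr0.
exists (fun x s => H x s - cobd (cyc_prim D) x s); split.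
- exact/equivariantB/equivariant_cobd.
- move=> x s sm; apply/eqP; rewrite cycB -subr_eq0 -oppr_eq0; apply/eqP.
  transitivity ((H x s - cyc H x s) -
    (cobd (cyc_prim D) x s - cyc (cobd (cyc_prim D)) x s)).
    by ring.
  rewrite (HT x s sm); case: s sm => // y s sm.
  rewrite sub_cyc_cobd -(eq_deg_tail_cobd Dz) // tail_cobdB.
  by rewrite tail_cobd_tail_cobd; ring.
- by move=> x s sm; rewrite FH // /cobd alt_delB alt_del_alt_del subr0.
Qed.

End Periodicity.

(** * The line of the dihedral group and Hochschild cocycles *)

Lemma dihedralM (m n : int) (s t : bool) :
  (((m, s) : dihedral) * ((n, t) : dihedral))%g
  = (m + Z2_act s n, s (+) t) :> dihedral.
Proof. by []. Qed.

Lemma dihedralV (m : int) (s : bool) :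
  ((m, s) : dihedral)^-1%g = (- Z2_act s m, s) :> dihedral.
Proof. by []. Qed.

Lemma int_step_const (T : Type) (u : int -> T) :
  (forall m, u (m + 1) = u m) -> forall m, u m = u 0.
Proof.
move=> uS; elim/int_rect => // n IH; first by rewrite -addn1 PoszD uS.
by rewrite -uS -addn1 PoszD opprD subrK.
Qed.

Section LineGraph.
Variable k : numFieldType.

(** The two reflections generate the group, whose Cayley graph is the line
      ... (m, true) -- (m, false) -- (m + 1, true) -- (m + 1, false) ...
    with edges labelled alternately by [refl0] and [refl1]. *)
Definition refl0 : dihedral := (0, true).
Definition refl1 : dihedral := (1, true).

Lemma dihedral_step_const (V : dihedral -> k) :
  (forall h, V (h * refl0)%g = V h) -> (forall h, V (h * refl1)%g = V h) ->
  forall h h', V h = V h'.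
Proof.
move=> V0 V1.
have Vt (m : int) s : V (m, s) = V (m, false).
  by case: s => //; rewrite -[RHS]V0 dihedralM /= addr0.
have VS (m : int) : V (m + 1, false) = V (m, false).
  by rewrite -[RHS]V1 dihedralM /= Vt.
have Vc h : V h = V (0, false).
  by case: h => m s; rewrite Vt (int_step_const (u := fun m => V (m, false))).
by move=> h h'; rewrite !Vc.
Qed.

(** The signs make [isumS] hold at negative m as well. *)
Definition isum (d : int -> k) (m : int) : k :=
  match m with
  | Posz n => \sum_(i < n) d i
  | Negz n => - \sum_(i < n.+1) d (Negz i)
  end.

Lemma isumS d m : isum d (m + 1) = isum d m + d m.
Proof.
case: m => [n|[|n]].
- by rewrite -PoszD addn1 /= big_ord_recr.
- by rewrite /= big_ord0 big_ord_recr big_ord0 /= add0r addNr.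
- have -> : Negz n.+1 + 1 = Negz n.
    by rewrite !NegzE -[n.+2]addn1 PoszD opprD subrK.
  by rewrite /= [in RHS]big_ord_recr /= opprD addrNK.
Qed.

(** The integral of E along the line from (0, false) to h. *)
Definition potential (E : dihedral -> dihedral -> k) (h : dihedral) : k :=
  let w m := isum (fun m => E (m, false) (m + 1, true) +
                            E (m + 1, true) (m + 1, false)) m in
  if h.2 then w h.1 - E (h.1, true) (h.1, false) else w h.1.

Variable E : dihedral -> dihedral -> k.
Hypothesis E_anti : forall y z, E z y = - E y z.

Lemma potential_refl0 h :
  potential E (h * refl0)%g = potential E h + E h (h * refl0)%g.
Proof.
case: h => m [] /=; rewrite dihedralM /potential /= ?oppr0 addr0.
  by rewrite subrK.
by rewrite [E (m, true) _]E_anti opprK.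
Qed.

Lemma potential_refl1 h :
  potential E (h * refl1)%g = potential E h + E h (h * refl1)%g.
Proof.
case: h => m [] /=; rewrite dihedralM /potential /=.
  rewrite -[in isum _ m](subrK 1 m) isumS subrK [E _ (m - 1, false)]E_anti.
  by ring.
by rewrite isumS addrA addrK.
Qed.

End LineGraph.

Section HochschildVanishing.
Variable k : numFieldType.
Implicit Types (F H : dihedral -> seq dihedral -> k).

Definition alt_edge F x t (y z : dihedral) : k :=
  2^-1 * (F x (y :: z :: t) - F x (z :: y :: t)).

Lemma alt_edge_anti F x t y z : alt_edge F x t z y = - alt_edge F x t y z.
Proof. by rewrite /alt_edge; ring. Qed.

(** On (h_0, h_1, ...) the potentials give the sum of F over the
    (v, v', h_1, ...), where (v, v') runs over the edges of the path from h_0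
    to h_1: these triangles fill the difference between that path and the edge
    (h_0, h_1), and the term that repeats h_0 accounts for the degenerate end
    of the filling. Antisymmetrizing the edges makes the sum insensitive to
    backtracking, hence additive when paths are composed. *)
Definition hcontract F : dihedral -> seq dihedral -> k := fun x s =>
  if s is y :: t then
    F x (y :: y :: t) -
    (potential (alt_edge F x t) (head y t) - potential (alt_edge F x t) y)
  else 0.

(** Potentials are not equivariant, but they are so up to a constant, as the
    group acts on the line by automorphisms. *)
Lemma equivariant_hcontract F : equivariant F -> equivariant (hcontract F).
Proof.
move=> eF g x [|y t] //=.
pose gx := (g * x * g^-1)%g; pose gt := [seq (g * y)%g | y <- t].
pose V h := potential (alt_edge F gx gt) (g * h)%g
  - potential (alt_edge F x t) h.
have eE h h' : alt_edge F gx gt (g * h)%g (g * h')%g = alt_edge F x t h h'.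
  by rewrite /alt_edge -[in RHS](eF g) -[F x (h' :: _)](eF g).
have Vc : forall h h', V h = V h'.
  apply: dihedral_step_const => h; rewrite /V mulgA.
    rewrite !potential_refl0; try exact: alt_edge_anti.
    by rewrite -(mulgA g h) eE; ring.
  rewrite !potential_refl1; try exact: alt_edge_anti.
  by rewrite -(mulgA g h) eE; ring.
rewrite -/gx -/gt; have -> : head (g * y)%g gt = (g * head y t)%g.
  by rewrite /gt; case: t {V eE Vc gt}.
rewrite -[F x _ in RHS](eF g); congr (_ - _).
have := Vc (head y t) y; rewrite /V => /eqP; rewrite subr_eq => /eqP ->; ring.
Qed.

(** The group has cohomological dimension 1 over a field of characteristic 0,
    so nothing survives in degree m + 2. *)
Lemma hochschild_exact m F : equivariant F ->
  eq_deg m.+4 (cobd F) (fun _ _ => 0) ->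
  eq_deg m.+3 F (cobd (hcontract F)).
Proof.
move=> eF cF x [//|h0 [//|h1 t]] [st].
have cl y z : alt_del (fun u => F x (y :: z :: h1 :: u)) t =
    F x (z :: h1 :: t) - F x (y :: h1 :: t) + F x (y :: z :: t).
  have := cF x [:: y, z, h1 & t]; rewrite /= st => /(_ erefl).
  rewrite /cobd /= => H; apply/eqP; rewrite -subr_eq0 -oppr_eq0; apply/eqP.
  by rewrite -[RHS]H; ring.
have clE y z : alt_del (fun u => alt_edge F x (h1 :: u) y z) t =
    F x (z :: h1 :: t) - F x (y :: h1 :: t) + alt_edge F x t y z.
  by rewrite /alt_edge alt_delZ alt_delB !cl; field.
(* By the cocycle relation V has the same value at neighbours, hence the same
   value at h_0 and h_1; this evaluates the part of the coboundary in which
   both h_0 and h_1 are kept. *)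
pose V y := alt_del (fun u => potential (alt_edge F x (h1 :: u)) y) t
   - (F x (y :: h1 :: t) + potential (alt_edge F x t) y).
have step r : (forall t' h, potential (alt_edge F x t') (h * r)%g =
      potential (alt_edge F x t') h + alt_edge F x t' h (h * r)%g) ->
    forall h, V (h * r)%g = V h.
  move=> pot h; rewrite /V.
  under eqf_alt_del => u do rewrite pot.
  by rewrite alt_delD clE pot; ring.
have Vc : forall h h', V h = V h'.
  by apply: dihedral_step_const; apply: step => t' h;
    [apply: potential_refl0 | apply: potential_refl1] => y z;
    apply: alt_edge_anti.
have := Vc h1 h0; rewrite /V => /eqP.
rewrite subr_eq => /eqP EV {step Vc V clE}.
case: t st cl EV => // h2 t _; set t' := h2 :: t => cl EV; rewrite /cobd.
have -> : alt_del (hcontract F x) [:: h0, h1 & t'] =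
   hcontract F x (h1 :: t') - (hcontract F x (h0 :: t')
     - alt_del (fun u => F x [:: h0, h0, h1 & u] -
          (potential (alt_edge F x (h1 :: u)) h1 -
           potential (alt_edge F x (h1 :: u)) h0)) t').
  by [].
rewrite !alt_delB cl EV /=; ring.
Qed.

End HochschildVanishing.

(** * Cyclic cocycles of degree 1 *)

Section Additive.
Variables (k : numFieldType) (G : groupType).
Implicit Types (F H : G -> seq G -> k) (x y : G) (s t : seq G).

Lemma closed1_add F x a b c : eq_deg 3 (cobd F) (fun _ _ => 0) ->
  F x [:: a; c] = F x [:: a; b] + F x [:: b; c].
Proof.
move=> cF; have := cF x [:: a; b; c] erefl; rewrite /cobd /= => E.
by apply/eqP; rewrite -subr_eq0 -oppr_eq0 -E; apply/eqP; ring.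
Qed.

Lemma closed1_refl F x a :
  eq_deg 3 (cobd F) (fun _ _ => 0) -> F x [:: a; a] = 0.
Proof.
move=> cF; have := closed1_add x a a a cF; move/eqP.
by rewrite -subr_eq subrr eq_sym => /eqP.
Qed.

(** The choice depends only on the conjugacy class, as a set. *)
Definition class_repr x : G :=
  xget 1%g [set y | exists g, y = g * x * g^-1]%g%classic.

Lemma class_reprJ g x : class_repr (g * x * g^-1)%g = class_repr x.
Proof.
congr (xget _ _); apply/seteqP; split=> y /= [h ->].
  by exists (h * g)%g; rewrite invgM !mulgA.
by exists (h * g^-1)%g; rewrite invgM invgK !mulgA !mulgVK.
Qed.

Definition transporter x : G :=
  xget 1%g [set g | g * class_repr x * g^-1 = x]%g%classic.

Lemma transporterP x :
  (transporter x * class_repr x * (transporter x)^-1 = x)%g.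
Proof.
have [g xg] : exists g, class_repr x = (g * x * g^-1)%g.
  apply: (@xgetPex _ 1%g [set y | exists g, y = g * x * g^-1]%g%classic).
  by exists x, 1%g; rewrite mul1g invg1 mulg1.
apply: (@xgetPex _ 1%g [set g | g * class_repr x * g^-1 = x]%g%classic).
by exists g^-1%g; rewrite /= xg invgK !mulgA mulVg mul1g mulgVK.
Qed.

(** F is the difference of the function h |-> F(x; w, h) for any base point w.
    To do this equivariantly the base point must move with x; carrying a fixed
    representative to x determines it up to the centralizer of x, and the
    hypothesis says that this ambiguity does not matter. *)
Lemma closed1_exact F : equivariant F -> eq_deg 3 (cobd F) (fun _ _ => 0) ->
    (forall x z h, commute x z -> F x [:: h; z * h]%g = 0) ->
  exists H, equivariant H /\ eq_deg 2 F (cobd H).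
Proof.
move=> eF cF F0.
exists (fun x s => if s is h :: _ then F x [:: transporter x; h] else 0); split.
  move=> g x [|h s] //=; rewrite -[RHS](eF g) /=.
  rewrite (closed1_add _ _ (g * transporter x)%g _ cF).
  set x' := (g * x * g^-1)%g; pose w := transporter x'.
  have -> : (g * transporter x = (g * transporter x * w^-1) * w)%g.
    by rewrite mulgVK.
  rewrite F0 ?add0r //; rewrite /commute.
  have := transporterP x'; rewrite -/w class_reprJ => E.
  have Ew : (w^-1 * x' = class_repr x * w^-1)%g.
    by rewrite -E !mulgA mulVg mul1g.
  rewrite -[RHS]mulgA Ew !mulgA; congr (_ * _)%g.
  rewrite /x' mulgVK -!mulgA; congr (_ * _)%g.
  by rewrite -{1}(transporterP x) mulgVK.
move=> x [//|a [//|b [|//]]] _; rewrite /cobd /= subr0.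
by rewrite (closed1_add x (transporter x) a b cF); ring.
Qed.

End Additive.

Section Degree1.
Variable k : numFieldType.
Implicit Types (F H : dihedral -> seq dihedral -> k).

(** For fixed x the map z |-> F(x; h, z h) is an additive character of the
    centralizer of x. It vanishes on elements of order 2, and at z = x because
    F is cyclic. Reflections have finite centralizers; that of S^p, p <> 0,
    consists of the powers of S, which are all commensurable with x; that of 1
    is generated by reflections. *)
Lemma cyclic1_commuting F : equivariant F -> eq_deg 3 (cobd F) (fun _ _ => 0) ->
  eq_deg 2 (cyc F) F ->
  forall x z h, commute x z -> F x [:: h; z * h]%g = 0.
Proof.
move=> eF cF lF.
have shift x a b c : commute x a -> F x [:: a * b; a * c]%g = F x [:: b; c].
  by move=> xa; rewrite -[RHS](eF a) /= -xa mulgK.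
have Fanti x a b : F x [:: a; b] = - F x [:: b; a].
  by apply/eqP; rewrite -addr_eq0 -(closed1_add x a b a cF) closed1_refl.
have F1 x z h : commute x z -> F x [:: h; z * h]%g = F x [:: 1; z]%g.
  move=> xz; rewrite (closed1_add _ _ 1%g _ cF) (closed1_add _ 1%g z _ cF).
  have := shift x z 1%g h xz; rewrite mulg1 => ->.
  by rewrite [F x [:: 1; h]%g]Fanti; ring.
have FM x a b : commute x a ->
    F x [:: 1; a * b]%g = F x [:: 1; a]%g + F x [:: 1; b]%g.
  move=> xa; rewrite (closed1_add _ _ a _ cF).
  by have := shift x a 1%g b xa; rewrite mulg1 => ->.
have Fx x : F x [:: 1; x]%g = 0.
  have := lF x [:: 1; 1]%g erefl; rewrite (closed1_refl _ _ cF) /cyc /=.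
  by rewrite expr1 mulN1r mulg1 => /eqP; rewrite oppr_eq0 => /eqP.
have refl x (m : int) : commute x ((m, true) : dihedral) ->
    F x [:: (1%g : dihedral); (m, true)] = 0.
  move=> xm; pose r : dihedral := (m, true).
  have rr : (r * r = 1)%g by rewrite dihedralM /= subrr.
  have := FM x r r xm; rewrite rr (closed1_refl _ _ cF).
  by move/esym/eqP; rewrite -mulr2n mulrn_eq0 => /eqP.
move=> x z h xz; rewrite F1 //.
case: z xz => m [] xz; first exact: refl.
case: x xz => p [].
  move/(congr1 fst); rewrite /= => /eqP.
  rewrite [p - m]addrC (inj_eq (addIr p)) eq_sym -addr_eq0 -mulr2n.
  rewrite mulrn_eq0 => /eqP ->.
  exact: closed1_refl.
pose S (n : int) : dihedral := (n, false); rewrite -/(S m) -/(S p).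
have [->|p0] := eqVneq p 0.
  have -> : S m = (((m, true) : dihedral) * refl0)%g.
    by rewrite dihedralM /= oppr0 addr0.
  by rewrite FM ?refl ?addr0 //; apply/commute_sym/commute1.
have SM a b : (S a * S b)%g = S (a + b) by [].
pose q n := F (S p) [:: 1%g; S n].
have qD a b : q (a + b) = q a + q b.
  by rewrite /q -SM FM // /commute !SM addrC.
have qS n : q n = n%:~R * q 1.
  elim/int_rect: n => [|n IH|n IH].
  - by rewrite mul0r /q; apply: closed1_refl.
  - by rewrite -addn1 PoszD qD IH intrD mulrDl mul1r.
  - apply: (addIr (q 1)).
    by rewrite -qD -addn1 PoszD opprD subrK IH intrD mulrDl mulN1r subrK.
have /eqP : q p = 0 := Fx (S p).
rewrite -/(q m) qS mulf_eq0 intr_eq0 (negPf p0) /= => /eqP q1.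
by rewrite qS q1 mulr0.
Qed.

End Degree1.

(** * Reduction of cyclic cocycles to class functions *)

Section ConstantCochains.
Variables (k : numFieldType) (G : groupType).
Implicit Types (F H : G -> seq G -> k) (tau : G -> k) (x y : G) (s t : seq G).

(** The homogeneous form of the functional tau(a_0 ... a_n); it is equivariant
    exactly when tau is a class function. *)
Definition const_cochain tau : G -> seq G -> k := fun x _ => tau x.

Lemma cobd_const tau x s :
  cobd (const_cochain tau) x s = if odd (size s) then tau x else 0.
Proof. exact: alt_del_const. Qed.

Lemma tail_cobd_const tau x s n : size s = n.+1 ->
  tail_cobd (const_cochain tau) x s = - (if odd n then tau x else 0).
Proof. by case: s => //= y s [<-]; rewrite alt_del_const. Qed.

Lemma cyc_const tau x s :
  cyc (const_cochain tau) x s = (-1) ^+ odd (size s).-1 * tau x.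
Proof. by rewrite /cyc signr_odd. Qed.

Lemma cyc_norm_const tau x s : odd (size s) ->
  cyc_norm (const_cochain tau) x s = (size s)%:R * tau x.
Proof.
move=> so; rewrite (@cyc_norm_id _ _ (size s)) // => y r rs.
by rewrite cyc_const rs; case: (size s) so => //= n /negPf ->; rewrite mul1r.
Qed.

(** Puts cyclic coboundaries in the form required by [periodicity_lift]: a
    cyclic cochain is the norm of a multiple of itself. *)
Lemma cyc_norm_tail_cobdZ n F : equivariant F -> eq_deg n.+1 (cyc F) F ->
  eq_deg n.+2 (cyc_norm (tail_cobd (fun x s => n.+1%:R^-1 * F x s))) (cobd F).
Proof.
move=> eF cF x s sn; rewrite -cobd_cyc_norm; last exact: equivariantZ.
apply: (eq_deg_cobd (n := n.+1)) sn => y r rn.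
rewrite (cyc_norm_id (n := n.+1)) // => [|z u un].
  by rewrite mulrA divff ?mul1r // pnatr_eq0.
by rewrite -(cF z u un) /cyc; ring.
Qed.

End ConstantCochains.

Section CyclicReduction.
Variable k : numFieldType.
Implicit Types (F H : dihedral -> seq dihedral -> k) (tau : dihedral -> k).

Lemma cyclic_odd_exact j F : equivariant F ->
    eq_deg j.*2.+3 (cobd F) (fun _ _ => 0) -> eq_deg j.*2.+2 (cyc F) F ->
  exists H, [/\ equivariant H, eq_deg j.*2.+1 (cyc H) H &
    eq_deg j.*2.+2 F (cobd H)].
Proof.
elim: j F => [|j IH] F eF cF lF.
  have [|H [eH FH]] := closed1_exact eF cF; first exact: cyclic1_commuting.
  exists H; split=> // x [//|h [|//]] _.
  by rewrite /cyc /= mul1r -[RHS]equivariant_self.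
have eK := equivariant_hcontract eF; have FK := hochschild_exact eF cF.
have [T [eT KT lT cT]] := periodicity_descend eK lF FK.
have [E [eE lE TE]] := IH _ (equivariant_cyc_norm eT) cT lT.
apply: (periodicity_lift eK eT (equivariantZ j.*2.+1%:R^-1 eE) FK KT).
by move=> x s sn; rewrite TE // cyc_norm_tail_cobdZ.
Qed.

(** Periodicity maps tau(a_0 ... a_(m+2)) to a nonzero multiple of
    tau(a_0 ... a_m), so a multiple of the former can be subtracted from F to
    make its image exact. *)
Lemma cyclic_even_reduce m F : ~~ odd m -> equivariant F ->
    eq_deg m.+4 (cobd F) (fun _ _ => 0) -> eq_deg m.+3 (cyc F) F ->
    (forall F', equivariant F' -> eq_deg m.+2 (cobd F') (fun _ _ => 0) ->
       eq_deg m.+1 (cyc F') F' ->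
     exists tau E, [/\ equivariant (const_cochain tau), equivariant E &
       eq_deg m.+1 F' (fun x s => tau x + cyc_norm (tail_cobd E) x s)]) ->
  exists tau H, [/\ equivariant (const_cochain tau), equivariant H,
    eq_deg m.+2 (cyc H) H & eq_deg m.+3 F (fun x s => tau x + cobd H x s)].
Proof.
move=> m_even eF cF lF IH.
have eK := equivariant_hcontract eF; have FK := hochschild_exact eF cF.
have [T [eT KT lT cT]] := periodicity_descend eK lF FK.
have [tau [E [etau eE TE]]] := IH _ (equivariant_cyc_norm eT) cT lT.
have m0 : m.+1%:R != 0 :> k by rewrite pnatr_eq0.
(* For the constant cochain tau the chase gives H = tau, T = - 2 tau, and
   the norm of T is - 2 (m + 1) tau. *)
pose c : k := - (2 * m.+1%:R)^-1.
pose ct := const_cochain (fun x => c * tau x).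
have ect : equivariant ct by apply: equivariantZ.
have [||x s sm|H [eH lH FH]] := @periodicity_lift _ _ m
  (fun x s => F x s - ct x s) (fun x s => hcontract F x s - ct x s)
  (fun x s => T x s - (-2) * ct x s) E
  (equivariantB eK ect) (equivariantB eT (equivariantZ _ ect)) eE.
- move=> x s sm; rewrite /cobd alt_delB -/(cobd ct x s) cobd_const sm /= m_even.
  by rewrite FK.
- move=> x s sm; rewrite tail_cobdB tail_cobdZ -KT // cycB.
  rewrite cyc_const sm /= m_even.
  by rewrite (tail_cobd_const _ _ sm) /= m_even /ct /const_cochain; ring.
- rewrite cyc_normB TE //.
  have -> : cyc_norm (fun x s => -2 * ct x s) x s = -2 * cyc_norm ct x s.
    by rewrite /cyc_norm mulr_sumr; apply: eq_bigr => i _; ring.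
  have so : odd (size s) by rewrite sm.
  rewrite cyc_norm_const {so}// sm /c.
  by field; rewrite nat1r.
exists (fun x => c * tau x), H; split=> // x s sm.
by rewrite -FH // addrC subrK.
Qed.

Lemma cyclic0_const F : equivariant F -> eq_deg 2 (cobd F) (fun _ _ => 0) ->
  exists2 tau, equivariant (const_cochain tau) & forall x y, F x [:: y] = tau x.
Proof.
move=> eF cF; have F1 x y : F x [:: y] = F x [:: 1%g].
  have := cF x [:: 1%g; y] erefl; rewrite /cobd /= subr0 => /eqP.
  by rewrite subr_eq0 => /eqP.
exists (fun x => F x [:: 1%g]) => // g x s.
by rewrite /const_cochain -[RHS](eF g) /= [RHS]F1.
Qed.

Lemma cyclic_even_const j F : equivariant F ->
    eq_deg j.*2.+4 (cobd F) (fun _ _ => 0) -> eq_deg j.*2.+3 (cyc F) F ->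
  exists tau H, [/\ equivariant (const_cochain tau), equivariant H,
    eq_deg j.*2.+2 (cyc H) H &
    eq_deg j.*2.+3 F (fun x s => tau x + cobd H x s)].
Proof.
elim: j F => [|j IH] F eF cF lF; apply: cyclic_even_reduce => //.
  move=> F' eF' cF' _; have [tau etau F't] := cyclic0_const eF' cF'.
  exists tau, (fun _ _ => 0); split=> // x [//|y [|//]] _.
  by rewrite F't /cyc_norm big_ord1 /= oppr0 mulr0 addr0.
by rewrite odd_double.
move=> F' eF' cF' lF'.
have [tau [H [etau eH lH FH]]] := IH _ eF' cF' lF'.
exists tau, (fun x s => (j.*2.+2)%:R^-1 * H x s); split=> //.
  exact: equivariantZ.
by move=> x s sj; rewrite FH // (cyc_norm_tail_cobdZ eH lH).
Qed.

(** Since 1 is the coboundary of the constant 1 in degree 1, one looks for a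
    primitive 1 + v(h) - v(g); it is cyclic when v(x h) = v(h) - 2, which for
    x = S^p is solved by - 2/p times the translation part. Such a v exists
    because x has infinite order. *)
Definition displacement tau : dihedral -> seq dihedral -> k := fun x s =>
  if s is [:: g; h] then tau x * (1 - 2 * (h.1 - g.1)%:~R / x.1%:~R) else 0.

Lemma displacementP tau : equivariant (const_cochain tau) ->
    (forall m, tau (m, true) = 0) -> tau (0, false) = 0 ->
  [/\ equivariant (displacement tau),
    eq_deg 2 (cyc (displacement tau)) (displacement tau) &
    eq_deg 3 (const_cochain tau) (cobd (displacement tau))].
Proof.
move=> etau tr t1.
have tauJ g x : tau (g * x * g^-1)%g = tau x := etau g x [::].
split.
- move=> g x [|a [|b [|//]]] //=; rewrite tauJ.
  case: x => p []; first by rewrite tr !mul0r.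
  congr (_ * (1 - _)); case: g a b => m [] [a s] [b t] /=.
    have -> : m - b - (m - a) = - (b - a) by ring.
    have -> : m - p - - - m = - p by ring.
    by rewrite !intrN invrN !mulrN mulNr opprK.
  have -> : m + b - (m + a) = b - a by ring.
  by rewrite [m + p]addrC addrK.
- move=> x [|a [|b [|//]]] //= _; rewrite /cyc /= expr1.
  case: x => p []; first by rewrite tr !mul0r mulr0.
  have [->|p0] := eqVneq p 0; first by rewrite t1 !mul0r mulr0.
  rewrite /= !(intrD, intrN); field.
  by rewrite intr_eq0.
- move=> x [|a [|b [|c [|//]]]] //= _; rewrite /cobd /= subr0 !(intrD, intrN).
  rewrite /const_cochain; ring.
Qed.

(** Periodicity transports the primitive found in degree 2 to every even
    degree. *)
Lemma const_hyperbolic_exact j tau : equivariant (const_cochain tau) ->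
    (forall m, tau (m, true) = 0) -> tau (0, false) = 0 ->
  exists H, [/\ equivariant H, eq_deg j.*2.+2 (cyc H) H &
    eq_deg j.*2.+3 (const_cochain tau) (cobd H)].
Proof.
move=> etau tr t1; elim: j => [|j [H [eH lH tH]]].
  by exists (displacement tau); have [] := displacementP etau tr t1.
have jo : ~~ odd j.*2.+2 by rewrite /= negbK odd_double.
pose T x s := -2 * const_cochain tau x s.
pose E x s := -2 * j.*2.+3%:R * (j.*2.+2%:R^-1 * H x s).
apply: (@periodicity_lift _ _ j.*2.+2 (const_cochain tau)
  (const_cochain tau) T E) => //.
- exact: equivariantZ.
- exact/equivariantZ/equivariantZ.
- by move=> x s sj; rewrite cobd_const sj /= odd_double.
- move=> x s sj; rewrite tail_cobdZ (tail_cobd_const _ _ sj) cyc_const sj /=.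
  by rewrite odd_double /const_cochain /=; ring.
- move=> x s sj.
  have cyc_normZ c F : cyc_norm (fun x s => c * F x s) x s = c * cyc_norm F x s.
    by rewrite /cyc_norm mulr_sumr; apply: eq_bigr => i _; ring.
  have so : odd (size s) by rewrite sj /= odd_double.
  rewrite cyc_normZ cyc_norm_const // sj.
  have -> : cyc_norm (tail_cobd E) x s = -2 * j.*2.+3%:R *
      cyc_norm (tail_cobd (fun x s => j.*2.+2%:R^-1 * H x s)) x s.
    by rewrite -cyc_normZ; apply: eq_bigr => i _; rewrite tail_cobdZ.
  by rewrite cyc_norm_tail_cobdZ // -tH // mulrA.
Qed.

(** The general class function: conjugation changes the translation part of a
    reflection by an even number, and that of a translation by a sign. *)
Definition class_fun (a b c : k) (d : nat -> k) : dihedral -> k := fun x =>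
  if x.2 then (if odd `|x.1| then c else b)
  else if x.1 == 0 then a else d `|x.1|%N.

Lemma dihedralJ (m p : int) (s t : bool) :
  (((m, s) : dihedral) * ((p, t) : dihedral) * ((m, s) : dihedral)^-1)%g =
  ((if t then m + m else 0) + Z2_act s p, t) :> dihedral.
Proof.
rewrite dihedralV !dihedralM addbAC addbb /=.
by case: s t => [] [] /=; congr (_, _); ring.
Qed.

Lemma class_funJ a b c d : equivariant (const_cochain (class_fun a b c d)).
Proof.
move=> [m s] [p t] l; rewrite /const_cochain dihedralJ /class_fun /=.
have absN : `|Z2_act s p|%N = `|p|%N by case: s => //=; rewrite abszN.
case: t; last by rewrite add0r absN; case: s {absN} => //=; rewrite oppr_eq0.
have -> // : odd `|m + m + Z2_act s p| = odd `|p| by case: s {absN} => /=; lia.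
Qed.

Lemma class_funE tau : equivariant (const_cochain tau) ->
  tau =1 class_fun (tau 1%g) (tau refl0) (tau refl1)
           (fun p => tau (Posz p, false)).
Proof.
move=> etau; have tauJ g x : tau (g * x * g^-1)%g = tau x := etau g x [::].
have tauM (m p : int) : tau (m + m + p, true) = tau (p, true).
  by rewrite -[RHS](tauJ (m, false)) dihedralJ.
case=> m []; rewrite /class_fun /=.
  have [q ->] : exists q : int, m = q + q + (odd `|m| : nat).
    case: m => n; [exists (Posz n./2) | exists (- (Posz (uphalf n.+1)))]; lia.
  rewrite tauM; have -> : odd `|q + q + (odd `|m| : nat)| = odd `|m| by lia.
  by case: (odd _).
case: eqP => [->//|_]; case: m => // n.
by rewrite -(tauJ refl0) dihedralJ /= add0r NegzE opprK.
Qed.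

Lemma cyclic_even_elliptic j F : equivariant F ->
    eq_deg j.*2.+4 (cobd F) (fun _ _ => 0) -> eq_deg j.*2.+3 (cyc F) F ->
  exists a b c H, [/\ equivariant H, eq_deg j.*2.+2 (cyc H) H &
    eq_deg j.*2.+3 F (fun x s => class_fun a b c (fun=> 0) x + cobd H x s)].
Proof.
move=> eF cF lF; have [tau [H [etau eH lH FH]]] := cyclic_even_const eF cF lF.
have tauE := class_funE etau; set a := tau _ in tauE; set b := tau _ in tauE.
set c := tau _ in tauE; set d := (fun p => _) in tauE.
have [|||H' [eH' lH' tH']] := @const_hyperbolic_exact j (class_fun 0 0 0 d).
- exact: class_funJ.
- by move=> m; rewrite /class_fun /=; case: ifP.
- by [].
exists a, b, c, (fun x s => H x s + H' x s); split.
- by move=> g x s; rewrite eH eH'.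
- move=> x s sj; rewrite -[in RHS]lH // -[in RHS]lH' // /cyc; ring.
- move=> x s sj; rewrite FH // /cobd alt_delD -/(cobd H' x s) -tH' //.
  rewrite [_ + const_cochain _ _ _]addrC addrA; congr (_ + _).
  rewrite tauE /const_cochain /class_fun.
  by case: (x.2); [case: (odd _) | case: (x.1 == 0)]; rewrite ?addr0 ?add0r.
Qed.

End CyclicReduction.

(** * Multilinear functionals *)

Section Multilinear.
Variables (k : numFieldType) (A : algType k).

Lemma dfwithE (I : eqType) (T : Type) (a : I -> T) i x j :
  @dfwith _ (fun=> T) a i x j = if j == i then x else a j.
Proof.
rewrite eq_sym; case: eqVneq => [<-|ij]; first by rewrite dfwith_in.
by rewrite dfwith_out.
Qed.

Lemma multilinearP n c (phi psi : functional A n) :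
  multilinear phi -> multilinear psi -> multilinear (c *: phi + psi).
Proof.
move=> mphi mpsi a i d x y.
have lcE b : (c *: phi + psi) b = c * phi b + psi b by [].
by rewrite !lcE mphi mpsi !mulrDr addrACA mulrCA.
Qed.

Lemma multilinear0 n : multilinear (0 : functional A n).
Proof. by move=> a p c x y; rewrite -[RHS]/(c * 0 + 0) mulr0 addr0. Qed.

Lemma multilinearZ n c (phi : functional A n) :
  multilinear phi -> multilinear (c *: phi).
Proof.
by move=> mphi; rewrite -[c *: phi]addr0; apply/multilinearP/multilinear0.
Qed.

(** A face map is linear in each argument when changing one argument changes
    one entry of the face, linearly. *)
Lemma multilinear_comp n m (phi : functional A n)
    (face : ('I_m.+1 -> A) -> ('I_n.+1 -> A)) :
    (forall a p, exists j (L : A -> A),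
      (forall c x y, L (c *: x + y) = c *: L x + L y) /\
      forall x, face (@dfwith _ (fun=> A) a p x) =
                @dfwith _ (fun=> A) (face a) j (L x)) ->
  multilinear phi -> multilinear ((phi \o face) : functional A m).
Proof.
move=> faceP mphi a p c x y; have [j [L [Llin fE]]] := faceP a p.
by rewrite /= !fE Llin mphi.
Qed.

Lemma multilinear_inner_face n (phi : functional A n) (i : 'I_n.+1) :
  multilinear phi -> multilinear ((phi \o inner_face i) : functional A n.+1).
Proof.
apply: multilinear_comp => a p.
have ordE m (u v : 'I_m) : (u == v) = (u == v :> nat) by [].
have [lt_pi|lt_ip|p_i] := ltngtP p i.
- have pn : (p < n.+1)%N by apply: ltn_trans lt_pi _.
  exists (Ordinal pn), id; split=> // x; apply: funext => q.
  rewrite !dfwithE /inner_face !dfwithE !ordE /= /bump /=.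
  have [qi|qi|qi] := ltngtP q i => //=.
    have -> : (1 + q == p)%N = false by lia.
    by have -> : (q == p :> nat) = false by lia.
  have -> : (i == p :> nat) = false by lia.
  have -> : (1 + i == p)%N = false by lia.
  by have -> : (q == p :> nat) = false by lia.
- have pn : (p.-1 < n.+1)%N by case: p lt_ip => -[].
  have [p_i|p_i] := eqVneq (p : nat) i.+1.
    exists i, (fun x => a (widen_ord (leqnSn _) i) * x); split=> [c x y|x].
      by rewrite mulrDr scalerAr.
    apply: funext => q.
    rewrite !dfwithE /inner_face !dfwithE !ordE /= /bump /= p_i.
    have [qi|qi|qi] := ltngtP q i => //=.
    + by have -> : (q == i.+1 :> nat) = false by lia.
    + by have -> : (1 + q == i.+1)%N = false by lia.
    + have -> : (i == i.+1 :> nat) = false by lia.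
      by have -> : (1 + i == i.+1)%N by lia.
  exists (Ordinal pn), id; split=> // x; apply: funext => q.
  rewrite !dfwithE /inner_face !dfwithE !ordE /= /bump /=.
  have [qi|qi|qi] := ltngtP q i => //=.
  + have -> : (q == p :> nat) = false by lia.
    by have -> : (q == p.-1 :> nat) = false by lia.
  + by have -> : (1 + q == p)%N = (q == p.-1 :> nat) by lia.
  + have -> : (i == p :> nat) = false by lia.
    have -> : (1 + i == p)%N = false by lia.
    by have -> : (q == p.-1 :> nat) = false by lia.
- exists i, (fun x => x * a (lift ord0 i)); split=> [c x y|x].
    by rewrite mulrDl scalerAl.
  apply: funext => q.
  rewrite !dfwithE /inner_face !dfwithE !ordE /= /bump /= p_i.
  have [qi|qi|qi] := ltngtP q i => //=.
    by have -> : (1 + q == i)%N = false by lia.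
  by rewrite eqxx; have -> : (1 + i == i)%N = false by lia.
Qed.

Lemma multilinear_outer_face n (phi : functional A n) :
  multilinear phi ->
  multilinear ((phi \o @outer_face k A n) : functional A n.+1).
Proof.
apply: multilinear_comp => a p.
have ordE m (u v : 'I_m) : (u == v) = (u == v :> nat) by [].
have [p0|p0] := eqVneq (p : nat) 0%N.
  exists ord0, (fun x => a ord_max * x); split=> [c x y|x].
    by rewrite mulrDr scalerAr.
  apply: funext => q; rewrite !dfwithE /outer_face !dfwithE !ordE /= p0 /=.
  by case: eqP.
have [pn|pn] := eqVneq (p : nat) n.+1.
  exists ord0, (fun x => x * a ord0); split=> [c x y|x].
    by rewrite mulrDl scalerAl.
  apply: funext => q; rewrite !dfwithE /outer_face !dfwithE !ordE /= pn eqxx /=.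
  have qn : (q < n.+1)%N := ltn_ord q.
  by case: eqP => // _; have -> : (q == n.+1 :> nat) = false by lia.
have pn' : (p < n.+1)%N by have : (p < n.+2)%N := ltn_ord p; lia.
exists (Ordinal pn'), id; split=> // x; apply: funext => q.
rewrite !dfwithE /outer_face !dfwithE !ordE /=.
have -> : (n.+1 == p :> nat) = false by lia.
have -> : (0%N == p :> nat) = false by lia.
by case: eqP => // ->; have -> : (0%N == p :> nat) = false by lia.
Qed.

Lemma multilinear_hochschild n (phi : functional A n) :
  multilinear phi -> multilinear (hochschild phi).
Proof.
move=> mphi.
have -> : hochschild phi =
    (-1) ^+ n.+1 *: ((phi \o @outer_face k A n) : functional A n.+1)
    + \sum_(i < n.+1) (-1) ^+ i *: ((phi \o inner_face i) : functional A n.+1).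
  apply: funext => a; rewrite /hochschild addrC !fctE; congr (_ + _).
  by rewrite fct_sumE.
apply: multilinearP; first exact: multilinear_outer_face.
elim/big_ind: _ => [|f g mf mg|i _].
- exact: multilinear0.
- by rewrite -[f]scale1r; apply: multilinearP.
- exact/multilinearZ/multilinear_inner_face.
Qed.

Lemma multilinear_cycle n (phi : functional A n) :
  multilinear phi ->
  multilinear ((fun a => phi (fun j => a (ord_pred j))) : functional A n).
Proof.
move=> mphi.
apply: (multilinear_comp (face := fun a j => a (ord_pred j))) => // a p.
exists (ordS p), id; split=> // x; apply: funext => q.
by rewrite !dfwithE (can2_eq (@ord_predK _) (@ordSK _)).
Qed.

End Multilinear.

(** * Functionals on a group algebra and homogeneous cochains *)

Section ListMultilinear.
Variables (k : numFieldType) (A : algType k).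

Definition list_multilinear (E : seq A -> k) :=
  forall l1 l2 c x y,
    E (l1 ++ (c *: x + y) :: l2) = c * E (l1 ++ x :: l2) + E (l1 ++ y :: l2).

Definition of_list n (E : seq A -> k) : functional A n :=
  fun a => E [seq a i | i <- enum 'I_n.+1].

Lemma multilinear_of_list n E :
  list_multilinear E -> multilinear (@of_list n E).
Proof.
move=> mE a i c x y; rewrite /of_list.
have mapE z : [seq @dfwith _ (fun=> A) a i z j | j <- enum 'I_n.+1] =
    [seq a j | j <- take i (enum 'I_n.+1)] ++
    z :: [seq a j | j <- drop i.+1 (enum 'I_n.+1)].
  apply: (@eq_from_nth _ 0) => [|j].
    rewrite size_map size_enum_ord size_cat size_map size_take size_enum_ord.
    rewrite ltn_ord [size (_ :: _)]/= size_map size_drop size_enum_ord.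
    by have : (i < n.+1)%N := ltn_ord i; lia.
  rewrite size_map size_enum_ord => jn.
  rewrite (nth_map i) ?size_enum_ord // nth_cat size_map size_take.
  rewrite size_enum_ord ltn_ord.
  have ij : (nth i (enum 'I_n.+1) j == i) = (j == i :> nat).
    by rewrite -val_eqE /= nth_enum_ord.
  rewrite dfwithE ij; have [ji|ji|->] := ltngtP j i.
  - by rewrite [RHS](nth_map i) ?nth_take // size_take size_enum_ord ltn_ord.
  - case: j jn ji {ij} => // j jn ji.
    rewrite subSn //= [RHS](nth_map i) ?nth_drop.
      by rewrite addSn subnKC.
    by rewrite size_drop size_enum_ord; have : (i < n.+1)%N := ltn_ord i; lia.
  - by rewrite subnn.
by rewrite !mapE mE.
Qed.

End ListMultilinear.

Section GroupAlgebra.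
Variables (k : numFieldType) (G : groupType).
Local Notation A := (grpalg k G).
Implicit Types (c : seq G -> k) (h : G -> k) (l : seq G) (a : A).

Definition basis (g : G) : A := << g >>.

Lemma basisM (x y : G) : basis x * basis y = basis (x * y)%g.
Proof. by rewrite -[LHS]/(grpalg_mul _ _) grpalg_mulUU mulr1. Qed.

Definition grpalg_ext h (a : A) : k := mmap idfun h a.

Lemma grpalg_ext_basis h g : grpalg_ext h (basis g) = h g.
Proof. by rewrite /grpalg_ext mmapU mul1r. Qed.

Lemma grpalg_ext_lin h d (a b : A) :
  grpalg_ext h (d *: a + b) = d * grpalg_ext h a + grpalg_ext h b.
Proof.
rewrite /grpalg_ext mmapD; congr (_ + _).
rewrite (mmapEw (msuppZ_le _ _)) mmapE mulr_sumr.
by apply: eq_bigr => g _; rewrite mcoeffZ mulrA.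
Qed.

Lemma eq_grpalg_ext h h' a : h =1 h' -> grpalg_ext h a = grpalg_ext h' a.
Proof.
by move=> hh; rewrite /grpalg_ext !mmapE; apply: eq_bigr => g _; rewrite hh.
Qed.

Lemma grpalg_ext_linl h h' d a :
  grpalg_ext (fun g => d * h g + h' g) a = d * grpalg_ext h a + grpalg_ext h' a.
Proof.
rewrite /grpalg_ext !mmapE mulr_sumr -big_split; apply: eq_bigr => g _ /=; ring.
Qed.

(** The multilinear extension of a function of group elements. *)
Fixpoint list_ext c (l : seq A) : k :=
  if l is a :: l' then grpalg_ext (fun g => list_ext (fun t => c (g :: t)) l') a
  else c [::].

Lemma list_ext_multilinear c : list_multilinear (list_ext c).
Proof.
move=> l1 l2 d x y; elim: l1 c => [|a l1 IH] c /=; first exact: grpalg_ext_lin.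
by rewrite -grpalg_ext_linl; apply: eq_grpalg_ext => g; rewrite IH.
Qed.

Lemma list_ext_basis c l : list_ext c [seq basis g | g <- l] = c l.
Proof. by elim: l c => //= g l IH c; rewrite grpalg_ext_basis IH. Qed.

Lemma scalar_basis_eq (f f' : A -> k) :
  scalar f -> scalar f' -> (forall g, f (basis g) = f' (basis g)) -> f =1 f'.
Proof.
move=> lf lf' ff.
have s0 (u : A -> k) : scalar u -> u 0 = 0.
  move=> lu; have := lu 1 0 0; rewrite scale1r addr0 mul1r => /eqP.
  by rewrite -subr_eq subrr eq_sym => /eqP.
elim/grpalg_ind => [|a b IHa IHb|c g]; first by rewrite !s0.
  by rewrite -[a]scale1r lf lf' IHa IHb.
have -> : << c *g g >> = c *: basis g + 0.
  by rewrite addr0 /basis grpalgZU mulr1.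
by rewrite lf lf' ff !s0.
Qed.

(** The arguments are replaced by basis elements one position after the other;
    m counts those which are still arbitrary. *)
Lemma multilinear_basis_eq n (phi psi : functional A n) :
  multilinear phi -> multilinear psi ->
  (forall g : 'I_n.+1 -> G,
     phi (fun i => basis (g i)) = psi (fun i => basis (g i))) ->
  phi = psi.
Proof.
move=> mphi mpsi pp; apply: funext => a.
suff main m : (m <= n.+1)%N -> forall b : 'I_n.+1 -> A,
    (forall i : 'I_n.+1, (m <= i)%N -> exists g, b i = basis g) ->
    phi b = psi b.
  by apply: (main n.+1) => // i; rewrite leqNgt ltn_ord.
elim: m => [|m IH] mn b bg.
  have [g gb] := fin_all_exists (fun i => bg i (leq0n _)).
  by have -> : b = (fun i => basis (g i)) by exact: funext.
pose i0 : 'I_n.+1 := Ordinal mn.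
have -> : b = @dfwith _ (fun=> A) b i0 (b i0).
  by apply: funext => j; rewrite dfwithE; case: eqP => [->|].
move: (b i0); apply: scalar_basis_eq => [||g]; [exact: mphi | exact: mpsi|].
apply: IH; first exact: ltnW.
move=> i mi; rewrite dfwithE; case: eqP => [_|ii0]; first by exists g.
apply: bg; rewrite ltn_neqAle mi andbT; apply/eqP => E; apply: ii0.
exact: val_inj.
Qed.

End GroupAlgebra.

Section Coordinates.
Variable G : groupType.
Implicit Types (x y z : G) (s t l : seq G).

(** The passage from (x; h_0, ..., h_n) to (g_0, ..., g_n). *)
Definition edge_labels x s : seq G :=
  if s is h :: t then
    ((last h t)^-1 * x * h)%g :: pairmap (fun a b => a^-1 * b)%g h t
  else [::].

Lemma size_edge_labels x s : size (edge_labels x s) = size s.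
Proof. by case: s => //= h t; rewrite size_pairmap. Qed.

Lemma edge_labels1 x : edge_labels x [:: 1%g] = [:: x].
Proof. by rewrite /= invg1 mul1g mulg1. Qed.

Lemma nth_edge_labels0 x s : (0 < size s)%N ->
  nth 1%g (edge_labels x s) 0 = ((nth 1 s (size s).-1)^-1 * x * nth 1 s 0)%g.
Proof. by case: s => //= h t _; rewrite (last_nth 1%g). Qed.

Lemma nth_edge_labelsS x s j : (j.+1 < size s)%N ->
  nth 1%g (edge_labels x s) j.+1 = ((nth 1 s j)^-1 * nth 1 s j.+1)%g.
Proof. by case: s => //= h t jt; rewrite (nth_pairmap 1%g). Qed.

Lemma edge_labels_conj g x s :
  edge_labels (g * x * g^-1)%g [seq (g * y)%g | y <- s] = edge_labels x s.
Proof.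
case: s => //= h t; congr (_ :: _).
  by rewrite last_map invgM -!mulgA mulKg (mulgA g^-1%g) mulVg mul1g.
by elim: t h => //= z t IH h; rewrite IH invgM -mulgA mulKg.
Qed.

(** With [holonomy], the section of [edge_labels] normalized by h_0 = 1. *)
Definition vertices l : seq G :=
  if l is _ :: t then 1%g :: scanl (fun a b => a * b)%g 1%g t else [::].
Definition holonomy l : G := (last 1 (vertices l) * head 1 l)%g.

Lemma size_vertices l : size (vertices l) = size l.
Proof. by case: l => //= h t; rewrite size_scanl. Qed.

Lemma verticesK l : edge_labels (holonomy l) (vertices l) = l.
Proof.
case: l => //= h t; congr (_ :: _); first by rewrite /holonomy /= mulg1 mulKg.
have mulK (a : G) : cancel (fun b => a * b)%g (fun b => a^-1 * b)%g := mulKg a.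
exact: (scanlK mulK).
Qed.

Lemma vertices_edge_labels x h t :
  vertices (edge_labels x (h :: t)) = [seq (h^-1 * y)%g | y <- h :: t].
Proof.
have shift (a : G) : scanl (fun b c => b * c)%g (a * h)%g
    (pairmap (fun b c => b^-1 * c)%g h t) = [seq (a * y)%g | y <- t].
  elim: t h => //= z t IH h; have -> : (a * h * (h^-1 * z) = a * z)%g.
    by rewrite -mulgA mulVKg.
  by rewrite IH.
by have := shift h^-1%g; rewrite /= mulVg => ->.
Qed.

Lemma holonomy_edge_labels x h t :
  holonomy (edge_labels x (h :: t)) = (h^-1 * x * h^-1^-1)%g.
Proof.
by rewrite /holonomy vertices_edge_labels /= invgK last_map -!mulgA mulVKg.
Qed.

Lemma prod_edge_labels x h t :
  foldr (fun a b => a * b)%g 1%g (edge_labels x (h :: t))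
  = ((last h t)^-1 * x * last h t)%g.
Proof.
rewrite /=; have -> : forall z u, foldr (fun a b => a * b)%g 1%g
    (pairmap (fun a b => a^-1 * b)%g z u) = (z^-1 * last z u)%g.
  move=> z u; elim: u z => [|w u IH] z /=; first by rewrite mulVg.
  by rewrite IH -mulgA mulVKg.
by rewrite -!mulgA mulVKg.
Qed.

Lemma edge_labels_trot x h t : edge_labels x (trot x (h :: t)) =
  rcons (pairmap (fun a b => a^-1 * b)%g h t) ((last h t)^-1 * x * h)%g.
Proof.
case: t => [|z u] /=; first by rewrite invgM -!mulgA mulKg.
rewrite last_rcons invgM mulgVK; congr (_ :: _).
by elim: u z => [|w u IH] z /=; rewrite ?IH // mulgA.
Qed.

Lemma nth_del_lt s i j : (j < i)%N -> nth 1%g (del i s) j = nth 1%g s j.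
Proof.
move=> ji; rewrite /del nth_cat size_take.
case: (ltnP i (size s)) => is_; first by rewrite ji nth_take.
case: (ltnP j (size s)) => js; first by rewrite take_oversize.
rewrite drop_oversize; last exact: leqW.
by rewrite nth_nil nth_default.
Qed.

Lemma nth_del_ge s i j : (i <= j)%N -> nth 1%g (del i s) j = nth 1%g s j.+1.
Proof.
move=> ij; rewrite /del nth_cat size_take.
case: (ltnP i (size s)) => is_.
  by rewrite ltnNge ij nth_drop addSn subnKC.
rewrite ltnNge (leq_trans is_ ij) /= drop_oversize; last exact: leqW.
by rewrite nth_nil nth_default // leqW // (leq_trans is_).
Qed.

End Coordinates.

Section Transfer.
Variables (k : numFieldType) (G : groupType).
Local Notation A := (grpalg k G).
Implicit Types (F : G -> seq G -> k) (x y z : G) (s t l : seq G).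

Definition basis_tuple n x s : 'I_n.+1 -> A :=
  fun i => basis k (nth 1%g (edge_labels x s) i).

Definition cochain_of n (phi : functional A n) : G -> seq G -> k :=
  fun x s => phi (basis_tuple x s).

Lemma equivariant_cochain_of n (phi : functional A n) :
  equivariant (cochain_of phi).
Proof. by move=> g x s; rewrite /cochain_of /basis_tuple edge_labels_conj. Qed.

Lemma basis_tupleP n (g : 'I_n.+1 -> G) :
  exists x s, size s = n.+1 /\ (fun i => basis k (g i)) = basis_tuple x s.
Proof.
pose l := [seq g i | i <- enum 'I_n.+1].
have sl : size l = n.+1 by rewrite size_map size_enum_ord.
exists (holonomy l), (vertices l); split; first by rewrite size_vertices.
apply: funext => i; rewrite /basis_tuple verticesK; congr (basis _ _).
by rewrite /l (nth_map i) ?size_enum_ord // nth_ord_enum.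
Qed.

Lemma cochain_of_inj n (phi psi : functional A n) :
  multilinear phi -> multilinear psi ->
  eq_deg n.+1 (cochain_of phi) (cochain_of psi) -> phi = psi.
Proof.
move=> mphi mpsi E; apply: multilinear_basis_eq => // g.
by have [x [s [ss ->]]] := basis_tupleP g; apply: E.
Qed.

Lemma map_nth_enum n (T : Type) (f : G -> T) l : size l = n.+1 ->
  [seq f (nth 1%g l (i : 'I_n.+1)) | i <- enum 'I_n.+1] = [seq f g | g <- l].
Proof.
move=> sl; rewrite -[l in RHS](mkseq_nth 1%g) sl /mkseq -val_enum_ord.
by rewrite -!map_comp.
Qed.

Definition functional_of n F : functional A n :=
  of_list (list_ext (fun l => F (holonomy l) (vertices l))).

Lemma multilinear_functional_of n F :
  multilinear (functional_of F : functional A n).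
Proof. exact/multilinear_of_list/list_ext_multilinear. Qed.

Lemma cochain_of_functional_of n F : equivariant F ->
  eq_deg n.+1 (cochain_of (functional_of F : functional A n)) F.
Proof.
move=> eF x [//|h t] ss.
rewrite /cochain_of /functional_of /of_list /basis_tuple.
rewrite map_nth_enum ?size_edge_labels // list_ext_basis.
by rewrite holonomy_edge_labels vertices_edge_labels eF.
Qed.

Lemma inner_face_tuple n x s (i : 'I_n.+1) : size s = n.+2 ->
  inner_face i (basis_tuple x s) = basis_tuple x (del i s).
Proof.
move=> ss; have iS : (i < n.+1)%N := ltn_ord i.
have sd : size (del i s) = n.+1 by rewrite size_del ss // ltnW.
apply: funext => j; have jS : (j < n.+1)%N := ltn_ord j.
have ordE : (j == i) = (j == i :> nat) by [].
rewrite /inner_face /basis_tuple ordE /= /bump /= add1n basisM.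
rewrite [RHS]/basis.
have [ji|ji|ji] := ltngtP (j : nat) i.
- congr (basis k _); case: (nat_of_ord j) ji jS => [|j'] ji jS.
    by rewrite !nth_edge_labels0 ?sd ?ss //= nth_del_ge // nth_del_lt.
  rewrite !nth_edge_labelsS ?sd ?ss //; last exact: ltnW.
  by rewrite !nth_del_lt // ltnW.
- congr (basis k _); case: (nat_of_ord j) ji jS => [//|j'] ji jS.
  by rewrite !nth_edge_labelsS ?sd ?ss // !nth_del_ge // ltnW.
- congr (basis k _); rewrite ji.
  case: (nat_of_ord i) iS sd => [|i'] iS sd.
    rewrite nth_edge_labels0 ?ss // nth_edge_labelsS ?ss //.
    rewrite nth_edge_labels0 ?sd // !nth_del_ge //.
    by rewrite -!mulgA mulVKg.
  rewrite !nth_edge_labelsS ?ss ?sd //; last exact: ltnW.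
  by rewrite nth_del_lt // nth_del_ge // -!mulgA mulVKg.
Qed.

Lemma outer_face_tuple n x s : size s = n.+2 ->
  @outer_face k A n (basis_tuple x s) = basis_tuple x (del n.+1 s).
Proof.
move=> ss; have sd : size (del n.+1 s) = n.+1 by rewrite size_del ss.
apply: funext => j; have jS : (j < n.+1)%N := ltn_ord j.
have ordE : (j == ord0) = (j == 0%N :> nat) by [].
rewrite /outer_face /basis_tuple ordE /= basisM.
case: (nat_of_ord j) jS => [|j'] jS /=; congr (basis k _).
  rewrite nth_edge_labelsS ?ss // !nth_edge_labels0 ?ss ?sd // !nth_del_lt //.
  by rewrite -!mulgA mulVKg.
rewrite !nth_edge_labelsS ?ss ?sd //; last exact: ltnW.
by rewrite !nth_del_lt // ltnW.
Qed.

Lemma cochain_of_hochschild n (phi : functional A n) :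
  eq_deg n.+2 (cochain_of (hochschild phi)) (cobd (cochain_of phi)).
Proof.
move=> x s ss; rewrite /cobd alt_delE ss big_ord_recr /=.
rewrite /cochain_of /hochschild.
rewrite outer_face_tuple //; congr (_ + _).
by apply: eq_bigr => i _; rewrite inner_face_tuple.
Qed.

Lemma cycle_tuple n x s : size s = n.+1 ->
  (fun j => basis_tuple x (trot x s) (ord_pred j)) = basis_tuple x s
  :> ('I_n.+1 -> A).
Proof.
case: s => // h t [ss]; apply: funext => j; have jS : (j < n.+1)%N := ltn_ord j.
rewrite /basis_tuple; congr (basis _ _).
rewrite edge_labels_trot nth_rcons size_pairmap ss /=.
case: (nat_of_ord j) jS => [|j'] jS; first by rewrite modn_small // ltnn eqxx.
have jn : (j' < n)%N by [].
by rewrite addSn /= modnDr modn_small ?jn // ltnW.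
Qed.

Lemma cochain_of_cyclic n (phi : functional A n) :
  cyclic phi -> eq_deg n.+1 (cyc (cochain_of phi)) (cochain_of phi).
Proof.
move=> cphi x s ss; rewrite /cyc ss /= /cochain_of.
by rewrite -[in RHS](cycle_tuple x ss) cphi.
Qed.

Lemma cyclic_of_cochain n (phi : functional A n) : multilinear phi ->
  eq_deg n.+1 (cyc (cochain_of phi)) (cochain_of phi) -> cyclic phi.
Proof.
move=> mphi E a.
suff EF : (fun a => phi (fun j => a (ord_pred j))) = (-1) ^+ n *: phi
    :> functional A n.
  exact: (congr1 (fun f => f a) EF).
apply: multilinear_basis_eq => [||g]; first exact: (multilinear_cycle mphi).
  exact: multilinearZ.
have [x [s [ss gE]]] := basis_tupleP g.
rewrite -[LHS]/(phi (fun j => (fun i => basis k (g i)) (ord_pred j))) gE {gE}.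
case/lastP: s ss => [//|t z]; rewrite size_rcons => -[st].
have sE : rcons t z = trot x ((x^-1 * z)%g :: t) by rewrite /= mulVKg.
have ss : size ((x^-1 * z)%g :: t) = n.+1 by rewrite /= st.
rewrite sE; set s := (x^-1 * z)%g :: t in ss *.
by rewrite cycle_tuple // -[LHS](E _ _ ss) /cyc ss.
Qed.

End Transfer.

(** * Computation of the cohomology *)

Section QuotientIso.
Variables (k : nzRingType) (V W : lmodType k) (I : submodClosed V).

Lemma pi_quotmod0 : \pi_(quotmod I) 0 = 0.
Proof.
by apply: (addIr (\pi_(quotmod I) 0)); rewrite -pi_quotmodD addr0 add0r.
Qed.

Lemma quotmod_iso (f : V -> W) : linear f ->
    (forall w, exists v, f v = w) -> (forall v, f v = 0 <-> v \in I) ->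
  lmod_isomorphic (quotmod I) W.
Proof.
move=> lf fsurj fker.
pose F (x : quotmod I) := f (repr x).
have f0 : f 0 = 0 by apply/fker; apply: rpred0.
have fB u v : f (u - v) = f u - f v.
  by rewrite addrC -scaleN1r lf scaleN1r addrC.
have Fpi v : F (\pi_(quotmod I) v) = f v.
  apply/eqP; rewrite -subr_eq0 -fB; apply/eqP/fker/pi_quotmod_eq.
  by rewrite reprK.
have lF : linear F.
  move=> a x y; rewrite -[x]reprK -[y]reprK.
  rewrite -[a *: _]/(quotmod_scale _ _) pi_quotmod_scale -pi_quotmodD !Fpi.
  exact: lf.
have [g fg] := choice fsurj.
pose F' : {linear quotmod I -> W} :=
  HB.pack F (GRing.isLinear.Build _ _ _ _ F lF).
exists F', (fun w => \pi_(quotmod I) (g w)) => [x|w] /=; last by rewrite Fpi.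
rewrite -[RHS]reprK; apply/pi_quotmod_eq/fker.
by rewrite fB fg subrr.
Qed.

End QuotientIso.

Section TraceCocycle.
Variables (k : numFieldType) (G : groupType).
Local Notation A := (grpalg k G).

Definition trace_functional n (tau : G -> k) : functional A n :=
  of_list (fun l => grpalg_ext tau (\prod_(a <- l) a)).

Lemma multilinear_trace n tau :
  multilinear (trace_functional tau : functional A n).
Proof.
apply: multilinear_of_list => l1 l2 c x y.
rewrite !big_cat !big_cons /= -grpalg_ext_lin; congr grpalg_ext.
by rewrite mulrDl mulrDr -scalerAl -scalerAr.
Qed.

Lemma cochain_of_trace n tau : equivariant (const_cochain tau) ->
  eq_deg n.+1 (cochain_of (trace_functional tau : functional A n))
    (const_cochain tau).
Proof.
move=> etau x [//|h t] ss.
rewrite /cochain_of /trace_functional /of_list /basis_tuple.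
rewrite map_nth_enum ?size_edge_labels //.
have -> : \prod_(a <- [seq basis k g | g <- edge_labels x (h :: t)]) a =
    basis k (foldr (fun a b => a * b)%g 1%g (edge_labels x (h :: t))).
  elim: (edge_labels _ _) => [|g l IH]; first by rewrite big_nil.
  by rewrite big_cons IH basisM.
rewrite prod_edge_labels grpalg_ext_basis.
by have := etau (last h t)^-1%g x [::]; rewrite invgK.
Qed.

Lemma cyclic_cochain_functional n F : equivariant F -> eq_deg n.+1 (cyc F) F ->
  cyclic_cochain (functional_of F : functional A n).
Proof.
move=> eF lF; have FE := cochain_of_functional_of (n := n) eF.
split; first exact: multilinear_functional_of.
apply: cyclic_of_cochain; first exact: multilinear_functional_of.
by move=> x s ss; rewrite (eq_deg_cyc FE) // lF // FE.
Qed.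

Lemma closed_of_cocycle n (z : cocycle A n) :
  eq_deg n.+2 (cobd (cochain_of z)) (fun _ _ => 0).
Proof.
move=> x s ss; rewrite -cochain_of_hochschild //.
by case: z => phi /= /asboolP[_ ->].
Qed.

Lemma cyclic_of_cocycle n (z : cocycle A n) :
  eq_deg n.+1 (cyc (cochain_of z)) (cochain_of z).
Proof. by case: z => phi /= /asboolP[[_ cphi] _]; apply: cochain_of_cyclic. Qed.

Lemma multilinear_cocycle n (z : cocycle A n) : multilinear z.
Proof. by case: z => phi /= /asboolP[[]]. Qed.

Lemma coboundary_of_cochain n (z : cocycle A n.+1) H :
    equivariant H -> eq_deg n.+1 (cyc H) H ->
    eq_deg n.+2 (cochain_of z) (cobd H) ->
  z \in @coboundary_pred k A n.+1.
Proof.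
move=> eH lH zH; apply/asboolP; exists (functional_of H).
  exact: cyclic_cochain_functional.
apply: cochain_of_inj; first exact: multilinear_cocycle.
  exact/multilinear_hochschild/multilinear_functional_of.
move=> x s ss; rewrite cochain_of_hochschild // zH //.
by rewrite (eq_deg_cobd (cochain_of_functional_of eH)).
Qed.

Lemma trace_cocycle n tau : ~~ odd n -> equivariant (const_cochain tau) ->
  exists z : cocycle A n, cocycle_val z = trace_functional tau.
Proof.
move=> n_even etau.
have tP : (trace_functional tau : functional A n) \in @cocycle_pred k A n.
  have mt : multilinear (trace_functional tau : functional A n).
    exact: multilinear_trace.
  have tE := cochain_of_trace (n := n) etau.
  apply/asboolP; split; [split=> //|].
    apply: cyclic_of_cochain => // x s ss.
    by rewrite (eq_deg_cyc tE) // tE // cyc_const ss /= (negPf n_even) mul1r.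
  apply: cochain_of_inj.
  - exact: multilinear_hochschild.
  - exact: multilinear0.
  move=> x s ss; rewrite cochain_of_hochschild // (eq_deg_cobd tE) //.
  by rewrite cobd_const ss /= negbK (negPf n_even).
by exists (Cocycle tP).
Qed.

End TraceCocycle.

Section Idempotents.
Variables (k : numFieldType) (A : algType k) (p : A).
Hypothesis pp : p * p = p.

(** All the faces of (p, ..., p) are equal to (p, ..., p), on which a cyclic
    functional of odd degree vanishes. *)
Lemma hochschild_idempotent n (psi : functional A n) :
  odd n -> cyclic psi -> hochschild psi (fun=> p) = 0.
Proof.
move=> n_odd cpsi; have psi0 : psi (fun=> p) = 0.
  have := cpsi (fun=> p); rewrite -signr_odd n_odd mulN1r => /eqP.
  by rewrite -addr_eq0 -mulr2n mulrn_eq0 => /eqP.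
rewrite /hochschild big1 => [|i _]; last first.
  rewrite (_ : inner_face i _ = fun=> p) ?psi0 ?mulr0 //; apply: funext => j.
  by rewrite /inner_face pp; do 2?case: ifP.
rewrite (_ : outer_face _ = fun=> p) ?psi0 ?mulr0 ?addr0 //; apply: funext => j.
by rewrite /outer_face pp; case: ifP.
Qed.

Lemma prod_idempotent (T : Type) (l : seq T) : (0 < size l)%N ->
  \prod_(a <- [seq p | _ <- l]) a = p.
Proof.
case: l => // a l _; rewrite /= big_cons; elim: l => [|b l IH] /=.
  by rewrite big_nil mulr1.
by rewrite big_cons mulrA pp.
Qed.

End Idempotents.

Section Dihedral.
Variable k : numFieldType.
Local Notation A := (grpalg k dihedral).

Definition half_sum (r : dihedral) : A := 2^-1 *: (basis k 1%g + basis k r).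

Lemma half_sum_idem r : (r * r)%g = 1%g -> half_sum r * half_sum r = half_sum r.
Proof.
move=> rr; rewrite /half_sum -scalerAl -scalerAr mulrDl !mulrDr !basisM rr.
rewrite !mulg1 mul1g [basis k r + _]addrC -mulr2n -scaler_nat !scalerA.
by congr (_ *: _); field.
Qed.

(** One idempotent for each conjugacy class of elements of finite order. *)
Definition idempotent (i : 'I_3) : A :=
  match val i with
  | 0%N => basis k 1%g
  | 1%N => half_sum refl0
  | _ => half_sum refl1
  end.

Lemma idempotentP i : idempotent i * idempotent i = idempotent i.
Proof.
case: i => [[|[|[|//]]] i3]; rewrite /idempotent /=; last 2 first.
- by apply: half_sum_idem; rewrite dihedralM /= ?oppr0 ?addr0.
- by apply: half_sum_idem; rewrite dihedralM /= subrr.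
by rewrite basisM mulg1.
Qed.

Lemma trace_idempotent n tau (p : A) : p * p = p ->
  (trace_functional tau : functional A n) (fun=> p) = grpalg_ext tau p.
Proof.
move=> pp; rewrite /trace_functional /of_list prod_idempotent //.
by rewrite size_enum_ord.
Qed.

Lemma grpalg_ext_half_sum tau r :
  grpalg_ext tau (half_sum r) = 2^-1 * (tau 1%g + tau r).
Proof.
rewrite -[half_sum r]addr0 grpalg_ext_lin -[basis k 1%g]scale1r grpalg_ext_lin.
by rewrite !grpalg_ext_basis mul1r /grpalg_ext mmap0 addr0.
Qed.

Definition pairing n (z : cocycle A n) : 'rV[k]_3 :=
  \row_i (cocycle_val z (fun=> idempotent i) : k).

Lemma HC_odd n : odd n -> forall x : HC A n, x = 0.
Proof.
move=> n_odd x; rewrite -[x]reprK; set z := repr x.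
have [m nE] : exists m, n = m.*2.+1 by exists n./2; lia.
move: z; rewrite {x}nE => z.
have [H [eH lH zH]] := cyclic_odd_exact (equivariant_cochain_of z)
  (closed_of_cocycle z) (cyclic_of_cocycle z).
rewrite -[RHS](pi_quotmod0 (coboundary_pred (n := m.*2.+1))).
apply/pi_quotmod_eq; rewrite subr0; exact: coboundary_of_cochain zH.
Qed.

Lemma HC_even n : (0 < n)%N -> ~~ odd n -> lmod_isomorphic (HC A n) 'rV[k]_3.
Proof.
move=> n0 n_even.
have [j nE] : exists j, n = j.*2.+2 by exists n./2.-1; lia.
rewrite {n n0}nE in n_even *.
apply: (@quotmod_iso _ _ _ (coboundary_pred (n := j.*2.+2)) (@pairing _)).
- by move=> c x y; apply/rowP => i; rewrite !mxE.
- move=> w; pose a := w 0 0.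
  pose b := 2 * w 0 1 - a; pose c := 2 * w 0 2%:R - a.
  have [z zE] := trace_cocycle n_even (class_funJ a b c (fun=> 0)).
  exists z; apply/rowP => i; rewrite !mxE zE trace_idempotent; last first.
    exact: idempotentP.
  case: i => [[|[|[|//]]] i3]; rewrite /idempotent /=.
  + rewrite grpalg_ext_basis /class_fun /= /a; congr (w _ _); exact: val_inj.
  + rewrite grpalg_ext_half_sum /class_fun /= /b.
    have -> : Ordinal i3 = 1 by exact: val_inj.
    by field.
  + rewrite grpalg_ext_half_sum /class_fun /= /c.
    have -> : Ordinal i3 = 2%:R by exact: val_inj.
    by field.
move=> z; split=> [z0|].
  have [a [b [c [H [eH lH zH]]]]] := cyclic_even_elliptic
    (equivariant_cochain_of z) (closed_of_cocycle z) (cyclic_of_cocycle z).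
  have [psiM psiC] := cyclic_cochain_functional eH lH.
  set psi := functional_of H in psiM psiC.
  have zE : cocycle_val z =
      1 *: trace_functional (class_fun a b c (fun=> 0)) + hochschild psi.
    apply: cochain_of_inj; first exact: multilinear_cocycle.
      apply: multilinearP; first exact: multilinear_trace.
      exact: multilinear_hochschild.
    move=> x s ss; rewrite zH //.
    have := cochain_of_trace (class_funJ a b c (fun=> 0)) x ss.
    rewrite /const_cochain => <-.
    have psiE := @cochain_of_functional_of k _ j.*2.+1 H eH.
    rewrite -(eq_deg_cobd psiE) // -cochain_of_hochschild //.
    by rewrite /cochain_of -[RHS]/(1 * _ + _) mul1r.
  have pE i : grpalg_ext (class_fun a b c (fun=> 0)) (idempotent i) = 0.
    have := congr1 (fun u : 'rV_3 => u 0 i) z0; rewrite !mxE zE.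
    rewrite -[LHS]/(1 * _ + _) (hochschild_idempotent (idempotentP i)) //;
      last by rewrite /= odd_double.
    by rewrite addr0 mul1r trace_idempotent //; apply: idempotentP.
  have a0 : a = 0 by have := pE 0; rewrite grpalg_ext_basis.
  have b0 : b = 0.
    have := pE 1; rewrite grpalg_ext_half_sum /class_fun /= a0 add0r => /eqP.
    by rewrite mulf_eq0 invr_eq0 pnatr_eq0 => /eqP.
  have c0 : c = 0.
    have := pE 2%:R; rewrite grpalg_ext_half_sum /class_fun /= a0 add0r => /eqP.
    by rewrite mulf_eq0 invr_eq0 pnatr_eq0 => /eqP.
  apply: (coboundary_of_cochain eH lH) => x s ss; rewrite zH // a0 b0 c0.
  by rewrite /class_fun; case: x.2; case: ifP; rewrite add0r.
move=> /asboolP /= [psi [_ cpsi] zE]; apply/rowP => i; rewrite !mxE zE.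
apply: (hochschild_idempotent (idempotentP i)) cpsi.
by rewrite /= odd_double.
Qed.

Lemma HC_0 : lmod_isomorphic (HC A 0)
   ('rV[k]_3 * ({p : nat | (1 <= p)%N} -> k^o))%type.
Proof.
pose ev (z : cocycle A 0) (g : dihedral) : k := cocycle_val z (fun=> basis k g).
pose rep (i : 'I_3) : dihedral :=
  match val i with 0%N => 1%g | 1%N => refl0 | _ => refl1 end.
apply: (@quotmod_iso _ _ _ (coboundary_pred (n := 0)) (fun z =>
  (\row_i ev z (rep i), (fun p : {p : nat | (1 <= p)%N} =>
     ev z (Posz (val p), false) : k^o)))).
- move=> c x y; congr (_, _); by apply/rowP => i; rewrite !mxE.
- move=> [w v]; pose d p := oapp v 0 (insub p).
  have [z zE] := @trace_cocycle k dihedral 0 _ isT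
     (class_funJ (w 0 0) (w 0 1) (w 0 2%:R) d).
  have evE g : ev z g = class_fun (w 0 0) (w 0 1) (w 0 2%:R) d g.
    rewrite /ev zE /trace_functional /of_list.
    have -> : [seq basis k g | _ <- enum 'I_1] = [:: basis k g].
      by rewrite enum_ordSl enum_ord0.
    by rewrite big_seq1 grpalg_ext_basis.
  exists z; congr (_, _).
    apply/rowP => -[[|[|[|//]]] i3]; rewrite !mxE evE /class_fun /=;
    congr (w _ _); exact: val_inj.
  apply: funext => p; rewrite evE /class_fun /=.
  have -> : (Posz (val p) == 0) = false by case: p => -[].
  by rewrite /d valK.
move=> z; split=> [[z1 z2]|/asboolP /= z0]; last first.
  congr (_, _); first by apply/rowP => i; rewrite !mxE /ev z0.
  by apply: funext => p; rewrite /ev z0.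
have [tau etau zE] :=
  cyclic0_const (equivariant_cochain_of z) (closed_of_cocycle z).
have evE g : ev z g = tau g.
  rewrite -(zE g 1%g) /cochain_of /basis_tuple edge_labels1 /ev.
  by congr (cocycle_val z _); apply: funext => i; rewrite ord1.
apply/asboolP => /=.
apply: cochain_of_inj; [exact: multilinear_cocycle | exact: multilinear0 |].
move=> x [//|h [|//]] _; rewrite zE (class_funE etau).
have t i : tau (rep i) = 0.
  by rewrite -evE; have := congr1 (fun u : 'rV_3 => u 0 i) z1; rewrite !mxE.
rewrite (t 0) (t 1) (t 2%:R) /class_fun.
case: x.2; first by case: ifP.
case: eqP => // x0; rewrite -evE.
have px : (1 <= `|x.1|)%N by rewrite absz_gt0; apply/eqP.
pose p : {p : nat | (0 < p)%N} := exist (fun p : nat => (0 < p)%N) _ px.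
exact: (congr1 (fun u : {p : nat | (0 < p)%N} -> k^o => u p) z2).
Qed.

End Dihedral.

Theorem proposition11 (R : realType) :
  [/\ lmod_isomorphic (HC (grpalg R[i] dihedral) 0)
        ('rV[R[i]]_3 * ({p : nat | (1 <= p)%N} -> R[i]^o))%type,
      forall n : nat, odd n ->
        forall x : HC (grpalg R[i] dihedral) n, x = 0 &
      forall n : nat, (0 < n)%N -> ~~ odd n ->
        lmod_isomorphic (HC (grpalg R[i] dihedral) n) 'rV[R[i]]_3].
Proof.
by split; [exact: HC_0 | exact: HC_odd | exact: HC_even].
Qed.
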